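(* Let $0<a\le b$ and let $\mathcal{T}_{a,b}$ be the right-angled triangle with vertices $(0,b)$, $(a,0)$, $(0,0)$. Put $c=\sqrt{a^2+b^2}$, $\alpha=\arctan(a/b)$, $u=a+b+c$, $\tilde A=ab/2$, $h=a\cos\alpha$. The density function $g$ of the distance $t$ between two random points (chosen independently and uniformly) in $\mathcal{T}_{a,b}$ is given by $$g(t)=\begin{cases}\dfrac{2t}{\tilde A}\left[\pi+\dfrac1{\tilde A}\bigl(J^*(t)-ut\bigr)\right] & \text{if } 0\le t\le c,\\[2mm] 0 & \text{else,}\end{cases}$$ where $$J^*(t)=\begin{cases}J_1^*(0,t) & \text{if } 0\le t<h,\\ J_1^*(0,h)+J_2^*(h,t) & \text{if } h\le t<a,\\ J_1^*(0,h)+J_2^*(h,a)+J_3^*(a,t) & \text{if } a\le t<b,\\ J_1^*(0,h)+J_2^*(h,a)+J_3^*(a,b)+J_4^*(b,t) & \text{if } b\le t\le c\end{cases}$$ with $J_k^*(s,t)=H_k^*(t)-H_k^*(s)$, where $$H_1^*(t)=\frac{\Theta_1t^2}{8},$$ $$H_2^*(t)=\frac{\Theta_2t^2}{8}+\Theta_3L_1^*(t,h)+c\,L_2^*(t,h),$$ $$H_3^*(t)=at+\frac{\Theta_4t^2}{2}+\frac{\Theta_3}{2}L_1^*(t,h)+\frac c2L_2^*(t,h)+\frac{b}{2a}L_1^*(t,a)+\frac b2L_2^*(t,a),$$ $$H_4^*(t)=\Theta_5t+\frac{\Theta_6t^2}{8}+\frac{b}{2a}L_1^*(t,a)+\frac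 b2L_2^*(t,a)+\frac{a}{2b}L_1^*(t,b)+\frac a2L_2^*(t,b)$$ with, for $t\ge x>0$, $$L_1^*(t,x)=\frac12\left(x\sqrt{t^2-x^2}+t^2\arcsin\frac xt\right),\qquad L_2^*(t,x)=\sqrt{t^2-x^2}+x\arcsin\frac xt .$$
   Context: The constants $\Theta_1,\dots,\Theta_6$ are $$\Theta_1=\frac ab(2\alpha+\pi)+\frac{2b}{a}(\pi-\alpha)+6,\quad \Theta_2=\frac ab(2\alpha-\pi)-\frac{2b}{a}\alpha+6,\quad \Theta_3=\frac ab+\frac ba,$$ $$\Theta_4=1-\frac ba\alpha,\quad \Theta_5=a+b,\quad \Theta_6=\frac ab(2\alpha-\pi)-\frac{2b}{a}\alpha+2 .$$ The triangle $\mathcal{T}_{a,b}$ is understood as the closed convex set (with interior); $u$ is its perimeter, $\tilde A$ its area, $c$ its hypotenuse and $h$ its height over the hypotenuse. The two random points are independent and each is uniformly distributed in $\mathcal{T}_{a,b}$; $t$ is their Euclidean distance, and $g$ is the probability density (with respect to Lebesgue measure on $\mathbb{R}$) of this random variable. *)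

(* Defs.v *)
From HB Require Import structures.
From mathcomp Require Import all_boot all_order all_algebra.
From mathcomp Require Import all_classical all_reals all_analysis.

Set Implicit Arguments.
Unset Strict Implicit.
Unset Printing Implicit Defensive.

Import Order.TTheory GRing.Theory Num.Theory.
Import numFieldNormedType.Exports.

Local Open Scope classical_set_scope.
Local Open Scope ring_scope.

(* The canonical norm of R * R is the sup norm, hence the explicit formula. *)
Definition euclidean_dist (R : realType) (p q : R * R) : R :=
  Num.sqrt ((p.1 - q.1) ^+ 2 + (p.2 - q.2) ^+ 2).

(* The convex hull of p, q and r. *)
Definition triangle (R : realType) (p q r : R * R) : set (R * R) :=
  [set x | exists k l m : R,
    [/\ 0 <= k, 0 <= l, 0 <= m, k + l + m = 1
      & x = (k * p.1 + l * q.1 + m * r.1, k * p.2 + l * q.2 + m * r.2)]].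

Definition right_triangle (R : realType) (a b : R) : set (R * R) :=
  triangle (0, b) (a, 0) (0, 0).

Definition lebesgue_measure2 (R : realType) :
    set (measurableTypeR R * measurableTypeR R) -> \bar R :=
  (@lebesgue_measure R \x @lebesgue_measure R)%E.

(* Meaningful when 0 < area S < +oo. *)
Definition uniform_on (R : realType) (d : measure_display)
    (Omega : measurableType d) (P : probability Omega R)
    (X : {RV P >-> (measurableTypeR R * measurableTypeR R)%type})
    (S : set (R * R)) : Prop :=
  forall B, measurable B ->
    distribution P X B
    = (lebesgue_measure2 (B `&` S) / lebesgue_measure2 S)%E.

Definition independent_RVs (R : realType) (d d1 d2 : measure_display)
    (Omega : measurableType d) (T1 : measurableType d1)
    (T2 : measurableType d2) (P : probability Omega R)
    (X : {RV P >-> T1}) (Y : {RV P >-> T2}) : Prop :=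
  forall A B, measurable A -> measurable B ->
    P ((X @^-1` A) `&` (Y @^-1` B)) = (P (X @^-1` A) * P (Y @^-1` B))%E.

(* Z is a real random variable with density g. *)
Definition has_density (R : realType) (d : measure_display)
    (Omega : measurableType d) (P : probability Omega R)
    (Z : Omega -> measurableTypeR R) (g : measurableTypeR R -> R) : Prop :=
  [/\ measurable_fun setT Z, measurable_fun setT g, forall t, 0 <= g t
    & forall A : set (measurableTypeR R), measurable A ->
        P (Z @^-1` A) = (\int[@lebesgue_measure R]_(t in A) (g t)%:E)%E].

Definition hyp (R : realType) (a b : R) : R := Num.sqrt (a ^+ 2 + b ^+ 2).
Definition alpha (R : realType) (a b : R) : R := atan (a / b).
Definition perimeter (R : realType) (a b : R) : R := a + b + hyp a b.
Definition area (R : realType) (a b : R) : R := a * b / 2.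
Definition height (R : realType) (a b : R) : R := a * cos (alpha a b).

Definition Theta1 (R : realType) (a b : R) : R :=
  a / b * (2 * alpha a b + pi) + 2 * b / a * (pi - alpha a b) + 6.
Definition Theta2 (R : realType) (a b : R) : R :=
  a / b * (2 * alpha a b - pi) - 2 * b / a * alpha a b + 6.
Definition Theta3 (R : realType) (a b : R) : R := a / b + b / a.
Definition Theta4 (R : realType) (a b : R) : R := 1 - b / a * alpha a b.
Definition Theta5 (R : realType) (a b : R) : R := a + b.
Definition Theta6 (R : realType) (a b : R) : R :=
  a / b * (2 * alpha a b - pi) - 2 * b / a * alpha a b + 2.

(* L1 and L2 are only meant for 0 < x <= t. *)
Definition L1 (R : realType) (t x : R) : R :=
  (x * Num.sqrt (t ^+ 2 - x ^+ 2) + t ^+ 2 * asin (x / t)) / 2.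
Definition L2 (R : realType) (t x : R) : R :=
  Num.sqrt (t ^+ 2 - x ^+ 2) + x * asin (x / t).

Definition H1 (R : realType) (a b t : R) : R := Theta1 a b * t ^+ 2 / 8.
Definition H2 (R : realType) (a b t : R) : R :=
  Theta2 a b * t ^+ 2 / 8 + Theta3 a b * L1 t (height a b)
  + hyp a b * L2 t (height a b).
Definition H3 (R : realType) (a b t : R) : R :=
  a * t + Theta4 a b * t ^+ 2 / 2
  + Theta3 a b / 2 * L1 t (height a b) + hyp a b / 2 * L2 t (height a b)
  + b / (2 * a) * L1 t a + b / 2 * L2 t a.
Definition H4 (R : realType) (a b t : R) : R :=
  Theta5 a b * t + Theta6 a b * t ^+ 2 / 8
  + b / (2 * a) * L1 t a + b / 2 * L2 t a
  + a / (2 * b) * L1 t b + a / 2 * L2 t b.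

Definition J1 (R : realType) (a b s t : R) : R := H1 a b t - H1 a b s.
Definition J2 (R : realType) (a b s t : R) : R := H2 a b t - H2 a b s.
Definition J3 (R : realType) (a b s t : R) : R := H3 a b t - H3 a b s.
Definition J4 (R : realType) (a b s t : R) : R := H4 a b t - H4 a b s.

(* Only meant for 0 <= t <= hyp a b. *)
Definition Jstar (R : realType) (a b t : R) : R :=
  let h := height a b in
  if t < h then J1 a b 0 t
  else if t < a then J1 a b 0 h + J2 a b h t
  else if t < b then J1 a b 0 h + J2 a b h a + J3 a b a t
  else J1 a b 0 h + J2 a b h a + J3 a b a b + J4 a b b t.

Definition distance_density (R : realType) (a b t : R) : R :=
  if 0 <= t <= hyp a b then
    2 * t / area a b *
      (pi + (Jstar a b t - perimeter a b * t) / area a b)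
  else 0.

(* Main.v *)
Require Import Defs.
From HB Require Import structures.
From mathcomp Require Import all_boot all_order all_algebra.
From mathcomp Require Import all_classical all_reals all_analysis.
From mathcomp Require Import measurable_realfun ring lra.

Import Order.TTheory GRing.Theory Num.Theory.
Import numFieldNormedType.Exports.

Local Open Scope classical_set_scope.
Local Open Scope ring_scope.

(** Let N (x, y) = max (|x| / a, |y| / b, |x / a + y / b|). The intersection of
  the triangle T with its translate T + v is homothetic to T with ratio
  1 - N v, so its area is area T * (1 - N v)_+ ^ 2, and the distance has the
  law of |v| when v has density (1 - N v)_+ ^ 2 / area T. The unit ball of
  N is a centrally symmetric hexagon; on the cone over a side of it,
  parametrised by w in ]0, 1[ with points at distance rho w from the origin, the
  coordinates (s, w), where s = N v, have Jacobian proportional to s and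
  |v| = s * rho w. Tonelli and the substitution t = s * rho w then give the
  density of |v| as t times a sum over three sides of the integrals of
  rho w ^ -2 * (1 - t / rho w)_+ ^ 2 dw. These are elementary: with d the
  distance from the origin to the side and y the abscissa along the side measured
  from the foot of the perpendicular, they become integrals of
  d / (d ^ 2 + y ^ 2) * (1 - t / sqrt (d ^ 2 + y ^ 2))_+ ^ 2 dy, where d is h, a
  or b, and the four regimes of the statement come from the position of t with
  respect to d and to the distances of the vertices of the hexagon. *)

(** * Affine substitution *)

Section affine_substitution.
Variable R : realType.
Notation mu := (@lebesgue_measure R).
Notation MR := (measurableTypeR R).

Let aff (k c : R) : MR -> MR := fun x => k * x + c.

Let measurable_aff (k c : R) : measurable_fun [set: MR] (aff k c).
Proof.
apply: measurable_funD; last exact: measurable_cst.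
exact: measurable_funM.
Qed.

(** Lebesgue measure is determined by its values on half-open intervals, and the rescaled
    pushforward takes the same values there. *)
Lemma lebesgue_measure_affine (k c : R) (A : set R) : k != 0 -> measurable A ->
  mu A = (`|k|%:E * mu (aff k c @^-1` A))%E.
Proof.
move=> k0 mA.
have k1 : 0 <= `|k| by [].
have -> : (`|k|%:E * mu (aff k c @^-1` A))%E =
  mscale (NngNum k1) (pushforward mu (aff k c)) A by [].
apply: lebesgue_measure_unique => //.
move=> X /ocitvP[->|[[u v]/= uv ->]]; first by rewrite !measure0.
rewrite lebesgue_measure_itv/= lte_fin uv /mscale /= /pushforward.
have [kgt|klt|] := ltgtP k 0; last by move/eqP : k0.
  (* A negative slope exchanges the open and the closed end, which does not affect the length. *)
  rewrite (_ : _ @^-1` _ = `[(v - c) / k, (u - c) / k[%classic); last first.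
    apply/seteqP; split => x /=; rewrite !in_itv/= /aff.
      by rewrite ler_ndivrMr// ltr_ndivlMr// mulrC => /andP[? ?]; apply/andP; split; lra.
    by rewrite ler_ndivrMr// ltr_ndivlMr// mulrC => /andP[? ?]; apply/andP; split; lra.
  rewrite lebesgue_measure_itv/= lte_fin ltr_nM2r ?invr_lt0// ltrD2r uv.
  rewrite -EFinM -!EFinB; congr EFin; rewrite ltr0_norm//; field.
  by rewrite lt_eqF.
rewrite (_ : _ @^-1` _ = `](u - c) / k, (v - c) / k]%classic); last first.
  apply/seteqP; split => x /=; rewrite !in_itv/= /aff.
    by rewrite ler_pdivlMr// ltr_pdivrMr// mulrC => /andP[? ?]; apply/andP; split; lra.
  by rewrite ler_pdivlMr// ltr_pdivrMr// mulrC => /andP[? ?]; apply/andP; split; lra.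
rewrite lebesgue_measure_itv/= lte_fin ltr_pM2r ?invr_gt0// ltrD2r uv.
rewrite -EFinM -!EFinB; congr EFin; rewrite gtr0_norm//; field.
by rewrite gt_eqF.
Qed.

Lemma ge0_integral_affine (k c : R) (f : R -> \bar R) : k != 0 ->
  measurable_fun [set: MR] f -> (forall x, 0 <= f x)%E ->
  (\int[mu]_x f x = `|k|%:E * \int[mu]_x f (k * x + c)%R)%E.
Proof.
move=> k0 mf f0.
have k1 : 0 <= `|k| by [].
rewrite (eq_measure_integral (mscale (NngNum k1) (pushforward mu (aff k c)))).
  by rewrite ge0_integral_mscale// ge0_integral_pushforward.
by move=> A mA _; exact: lebesgue_measure_affine.
Qed.

End affine_substitution.

(** * From the plane to cones *)

(** Constraints are kept as 0-1 factors of the integrand, so that integrals run over the whole line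
    and substitutions act on the constraints too. *)
Local Notation "\1[ c ]" := (nat_of_bool c%R)%:R
  (at level 0, c at level 200, format "\1[ c ]") : ring_scope.

Lemma measurable_bool_natr (R : realType) (d : measure_display)
    (T : measurableType d) (D : set T) (f : T -> bool) :
  measurable_fun D f -> measurable_fun D (fun x => (f x)%:R : R).
Proof.
move=> mf; apply: (measurable_comp (F := setT) (f := fun c : bool => c%:R : R)) => //.
Qed.

(* Variables standing for measurable functions are discharged by the
   hypotheses of the context, which must be stated with [measurable_fun setT]. *)
Local Ltac meas :=
  lazymatch goal with
  | |- measurable_fun _ (fun x => EFin (@?f x)) => apply/measurable_EFinP; meas
  | |- measurable_fun _ (fun x => (@?f x) + (@?g x)) =>
      first [ apply: (@measurable_funD _ _ _ _ f g)
            | apply: (@emeasurable_funD _ _ _ _ f g) ]; meas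
  | |- measurable_fun _ (fun x => ((@?f x) * (@?g x))%E) =>
      apply: (@emeasurable_funM _ _ _ _ f g); meas
  | |- measurable_fun _ (fun x => (@?f x) * (@?g x)) =>
      apply: (@measurable_funM _ _ _ _ f g); meas
  | |- measurable_fun _ (fun x => - (@?f x)) =>
      apply: (@measurable_funN _ _ _ _ f); meas
  | |- measurable_fun _ (fun x => (@?f x) ^+ _) =>
      apply: (@measurable_funX _ _ _ _ f); meas
  | |- measurable_fun _ (fun x => Num.max (@?f x) (@?g x)) =>
      apply: (@measurable_maxr _ _ _ _ f g); meas
  | |- measurable_fun _ (fun x => Num.min (@?f x) (@?g x)) =>
      apply: (@measurable_minr _ _ _ _ f g); meas
  | |- measurable_fun _ (fun x => ((@?f x) < (@?g x))%R) =>
      apply: (@measurable_fun_ltr _ _ _ _ f g); meas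
  | |- measurable_fun _ (fun x => ((@?f x) <= (@?g x))%R) =>
      apply: (@measurable_fun_ler _ _ _ _ f g); meas
  | |- measurable_fun _ (fun x => (nat_of_bool (@?f x))%:R) =>
      apply: (@measurable_bool_natr _ _ _ _ f); meas
  | |- measurable_fun _ (fun x => (@?f x, @?g x)) =>
      apply: (@measurable_fun_pair _ _ _ _ _ _ f g); meas
  | |- measurable_fun _ (fun x => (@?f x).1) =>
      apply: (measurableT_comp measurable_fst (g := f)); meas
  | |- measurable_fun _ (fun x => (@?f x).2) =>
      apply: (measurableT_comp measurable_snd (g := f)); meas
  | H : measurable_fun setT (fun w => (?h w)^-1) |-
      measurable_fun _ (fun x => (?h (@?f x))^-1) =>
      apply: (measurableT_comp H (g := f)); meas
  | H : measurable_fun setT ?h |- measurable_fun _ (fun x => ?h (@?f x)) =>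
      apply: (measurableT_comp H (g := f)); meas
  | _ => first [ exact: measurable_cst | exact: measurable_id | assumption | idtac ]
  end.

Section plane.
Variable R : realType.
Notation mu := (@lebesgue_measure R).
Notation MR := (measurableTypeR R).


Lemma ae_neq (c : R) : {ae mu, forall x : MR, x != c}.
Proof.
exists [set c]; split; [exact: measurable_set1|exact: lebesgue_measure_set1|].
by move=> x /= /negP; rewrite negbK => /eqP.
Qed.

Lemma ge0_ae_eq_integral_neq (c : R) (f g : MR -> \bar R) :
  measurable_fun setT f -> measurable_fun setT g ->
  (forall x, 0 <= f x)%E -> (forall x, 0 <= g x)%E ->
  (forall x, x != c -> f x = g x) ->
  (\int[mu]_x f x = \int[mu]_x g x)%E.
Proof.
move=> mf mg f0 g0 fg; apply: ge0_ae_eq_integral => //.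
by apply: filterS (ae_neq c) => x /fg.
Qed.

(** The negative half-line is folded onto the positive one by reflection, the point 0 being
    negligible. *)
Lemma ge0_integral_half (f : MR -> \bar R) :
  measurable_fun setT f -> (forall x, 0 <= f x)%E ->
  (\int[mu]_x f x = \int[mu]_x (\1[0 < x]%:E * (f x + f (- x)%R)))%E.
Proof.
move=> mf f0.
have mfN : measurable_fun setT (fun x : MR => f (- x)).
  by apply: (measurableT_comp mf); meas.
have i0 (c : bool) : (0 <= (c%:R : R)%:E)%E by rewrite lee_fin.
have m1 : measurable_fun setT (fun x : MR => \1[0 < x]%:E * f x)%E.
  by apply: emeasurable_funM => //; meas.
have m2 : measurable_fun setT (fun x : MR => \1[x < 0]%:E * f x)%E.
  by apply: emeasurable_funM => //; meas.
have m3 : measurable_fun setT (fun x : MR => \1[0 < x]%:E * f (- x)%R)%E.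
  by apply: emeasurable_funM => //; meas.
rewrite (@ge0_ae_eq_integral_neq 0 f
  (fun x => \1[0 < x]%:E * f x + \1[x < 0]%:E * f x)%E) //; last 3 first.
- exact: emeasurable_funD.
- by move=> x; rewrite adde_ge0// mule_ge0.
- by move=> x; case: ltgtP => // _ _; rewrite mul1e mul0e ?adde0 ?add0e.
under [RHS]eq_integral do rewrite ge0_muleDr//.
rewrite ge0_integralD//; last 2 first.
- by move=> x _; rewrite mule_ge0.
- by move=> x _; rewrite mule_ge0.
rewrite ge0_integralD//; last 2 first.
- by move=> x _; rewrite mule_ge0.
- by move=> x _; rewrite mule_ge0.
congr (_ + _)%E.
rewrite (ge0_integral_affine _ (-1) 0)//; last by move=> x; rewrite mule_ge0.
rewrite normrN1 mul1e; apply: eq_integral => x _.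
by rewrite mulN1r addr0 oppr_lt0.
Qed.

(** Folding both axes produces four quadrants, which central symmetry identifies in pairs: hence the
    factor 2. *)
Lemma ge0_integral_plane (F : MR * MR -> R) :
  measurable_fun setT F -> (forall z, 0 <= F z) ->
  (forall x y, F (- x, - y) = F (x, y)) ->
  (\int[mu]_x \int[mu]_y (F (x, y))%:E =
   \int[mu]_x \int[mu]_y
     (\1[0 < x] * \1[0 < y] * (2 * (F (x, y) + F (- x, y))))%:E)%E.
Proof.
move=> mF F0 FN.
have mF1 : measurable_fun setT (EFin \o F) by exact/measurable_EFinP.
rewrite (ge0_integral_half (fun x => \int[mu]_y (F (x, y))%:E)%E)//; last 2 first.
- by apply: (measurable_fun_fubini_tonelli_F (EFin \o F)) => // z; rewrite lee_fin.
- by move=> x; apply: integral_ge0 => y _; rewrite lee_fin.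
apply: eq_integral => x _.
rewrite -ge0_integralD//=; first last.
- by meas.
- by move=> y _; rewrite lee_fin.
- by meas.
- by move=> y _; rewrite lee_fin.
rewrite -ge0_integralZl_EFin//=; first last.
- by meas.
- by move=> y _; rewrite -EFinD lee_fin addr_ge0.
rewrite ge0_integral_half//=; first last.
- by move=> y; rewrite -EFinD -EFinM lee_fin mulr_ge0// addr_ge0.
- by meas.
apply: eq_integral => y _.
rewrite -!EFinD -!EFinM; congr EFin; rewrite FN -[F (x, - y)]FN opprK; ring.
Qed.

(** The inner variable is rescaled by [s]; the new factor [s] is the Jacobian of the conical
    coordinates. *)
Lemma ge0_integral_scale (G : MR * MR -> R) :
  measurable_fun setT G -> (forall z, 0 <= G z) ->
  (\int[mu]_s \int[mu]_w (\1[0 < s] * G (s, w))%:E =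
   \int[mu]_s \int[mu]_w (\1[0 < s] * (s * G (s, s * w)))%:E)%E.
Proof.
move=> mG G0; apply: eq_integral => s _.
have [s0|s0] := ltP 0 s; last first.
  by under eq_integral do rewrite mul0r; under [RHS]eq_integral do rewrite mul0r.
rewrite (ge0_integral_affine _ s 0) ?gt_eqF//=; last 2 first.
- by meas.
- by move=> x; rewrite lee_fin mulr_ge0.
rewrite gtr0_norm// -ge0_integralZl_EFin ?ltW//; last 2 first.
- by move=> x _; rewrite lee_fin mulr_ge0.
- by meas.
by apply: eq_integral => w _; rewrite addr0 -EFinM !mul1r.
Qed.

Lemma tonelli_swap (G : MR * MR -> R) :
  measurable_fun setT G -> (forall z, 0 <= G z) ->
  (\int[mu]_x \int[mu]_y (G (x, y))%:E = \int[mu]_y \int[mu]_x (G (x, y))%:E)%E.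
Proof.
move=> mG G0; rewrite (fubini_tonelli (EFin \o G))//; first exact/measurable_EFinP.
Qed.

(** Brings the legs to length 1, so that in the folded quadrants the sides of the hexagon become
    [x + y = 1], [x = 1] and [y = 1]. *)
Lemma ge0_integral_dilation2 (a b : R) (G : MR * MR -> R) : 0 < a -> 0 < b ->
  measurable_fun setT G -> (forall z, 0 <= G z) ->
  (\int[mu]_x \int[mu]_y (G (x, y))%:E =
   (a * b)%:E * \int[mu]_x \int[mu]_y (G (a * x, b * y)%R)%:E)%E.
Proof.
move=> a0 b0 mG G0.
have mF : measurable_fun setT (fun x => \int[mu]_y (G (x, y))%:E)%E.
  apply: (measurable_fun_fubini_tonelli_F (EFin \o G)).
    exact/measurable_EFinP.
  by move=> z; rewrite lee_fin.
etransitivity.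
  apply: (ge0_integral_affine _ a 0 _ _ mF); first by rewrite gt_eqF.
  by move=> x; apply: integral_ge0 => y _; rewrite lee_fin.
rewrite (gtr0_norm a0) EFinM -[RHS]muleA; congr (_ * _)%E.
rewrite -ge0_integralZl_EFin ?ltW//; last 2 first.
- by move=> x _; apply: integral_ge0 => y _; rewrite lee_fin.
- apply: (measurable_fun_fubini_tonelli_F
    (fun z : MR * MR => (G (a * z.1, b * z.2))%:E)).
    by meas.
  by move=> z; rewrite lee_fin.
apply: eq_integral => x _; rewrite addr0.
rewrite (ge0_integral_affine _ b 0) ?gt_eqF//; last 2 first.
- by meas.
- by move=> y; rewrite lee_fin.
by rewrite gtr0_norm//; under eq_integral do rewrite addr0.
Qed.

(* The cone over the side [x + y = 1] of the unit ball, with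
   (x, y) = (s w, s (1 - w)). *)
Lemma ge0_integral_quadrant_sum (G : MR * MR -> R) :
  measurable_fun setT G -> (forall z, 0 <= G z) ->
  (\int[mu]_x \int[mu]_y (\1[0 < x] * \1[0 < y] * G (x, y))%:E =
   \int[mu]_s \int[mu]_w (\1[0 < s] * (\1[0 < w] * \1[w < 1] *
     (s * G (s * w, s * (1 - w)))))%:E)%E.
Proof.
move=> mG G0.
(* Shear: the inner variable becomes [s = x + y]. *)
transitivity (\int[mu]_x \int[mu]_s
    (\1[0 < x] * \1[0 < s - x] * G (x, s - x))%:E)%E.
  apply: eq_integral => x _.
  rewrite (ge0_integral_affine _ 1 (- x))//=.
  - by rewrite normr1 mul1e; apply: eq_integral => s _; rewrite mul1r.
  - by meas.
  - by move=> s; rewrite lee_fin !mulr_ge0.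
etransitivity.
  apply: (tonelli_swap (fun z => \1[0 < z.1] * \1[0 < z.2 - z.1] * G (z.1, z.2 - z.1))).
    by meas.
  by move=> z; rewrite !mulr_ge0.
rewrite /=.
(* The constraint [0 < s] follows from the other two; made explicit, it allows the rescaling of [x]
   by [s]. *)
transitivity (\int[mu]_s \int[mu]_x (\1[0 < s] *
    (\1[0 < x] * \1[0 < s - x] * G (x, s - x)))%:E)%E.
  apply: eq_integral => s _; apply: eq_integral => x _; congr EFin.
  have [x0|] := ltP 0 x; last by rewrite !(mul0r, mulr0).
  have [sx|] := ltP 0 (s - x); last by rewrite !(mul0r, mulr0).
  by rewrite (_ : 0 < s) ?mul1r//; lra.
etransitivity.
  apply: (ge0_integral_scale
    (fun z => \1[0 < z.2] * \1[0 < z.1 - z.2] * G (z.2, z.1 - z.2))).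
    by meas.
  by move=> z; rewrite !mulr_ge0.
rewrite /=.
apply: eq_integral => s _; apply: eq_integral => w _; congr EFin.
have [s0|] := ltP 0 s; last by rewrite !mul0r.
rewrite pmulr_rgt0// (_ : s - s * w = s * (1 - w)); last by ring.
by rewrite pmulr_rgt0// subr_gt0; ring.
Qed.

Lemma ge0_integral2D (A B : MR * MR -> R) :
  measurable_fun setT A -> measurable_fun setT B ->
  (forall z, 0 <= A z) -> (forall z, 0 <= B z) ->
  (\int[mu]_x \int[mu]_y (A (x, y) + B (x, y))%:E =
   \int[mu]_x \int[mu]_y (A (x, y))%:E + \int[mu]_x \int[mu]_y (B (x, y))%:E)%E.
Proof.
move=> mA mB A0 B0.
have mE (C : MR * MR -> R) : measurable_fun setT C -> (forall z, 0 <= C z) ->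
    measurable_fun setT (fun x => \int[mu]_y (C (x, y))%:E)%E.
  move=> mC C0; apply: (measurable_fun_fubini_tonelli_F (EFin \o C)).
    exact/measurable_EFinP.
  by move=> z; rewrite lee_fin.
have E0 (C : MR * MR -> R) : (forall z, 0 <= C z) ->
    forall x, (0 <= \int[mu]_y (C (x, y))%:E)%E.
  by move=> C0 x; apply: integral_ge0 => y _; rewrite lee_fin.
etransitivity; last first.
  apply: ge0_integralD; [by []|..].
  - by move=> x _; exact: E0.
  - exact: mE.
  - by move=> x _; exact: E0.
  - exact: mE.
apply: eq_integral => x _; etransitivity; last first.
  apply: ge0_integralD; [by []|..].
  - by move=> y _; rewrite lee_fin.
  - by meas.
  - by move=> y _; rewrite lee_fin.
  - by meas.
by apply: eq_integral.
Qed.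

(* The cones over the sides [x = 1] and [y = 1], with (x, y) = (s, s w) and
   (x, y) = (s w, s). *)
Lemma ge0_integral_quadrant_max (G : MR * MR -> R) :
  measurable_fun setT G -> (forall z, 0 <= G z) ->
  (\int[mu]_x \int[mu]_y (\1[0 < x] * \1[0 < y] * G (x, y))%:E =
   \int[mu]_s \int[mu]_w (\1[0 < s] * (\1[0 < w] * \1[w < 1] *
     (s * (G (s, s * w) + G (s * w, s)))))%:E)%E.
Proof.
move=> mG G0.
(* [G1] is the part below the diagonal; [G2] is the part on or above it with coordinates exchanged,
   so that the larger one comes first; [G3] is [G2] without the diagonal. *)
pose G1 z := \1[0 < z.2] * \1[z.2 < z.1] * G (z.1, z.2).
pose G2 z := \1[0 < z.2] * \1[z.2 <= z.1] * G (z.2, z.1).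
pose G3 z := \1[0 < z.2] * \1[z.2 < z.1] * G (z.2, z.1).
have mG1 : measurable_fun setT (G1 : MR * MR -> R) by rewrite /G1; meas.
have mG2 : measurable_fun setT (G2 : MR * MR -> R) by rewrite /G2; meas.
have mG3 : measurable_fun setT (G3 : MR * MR -> R) by rewrite /G3; meas.
have G10 z : 0 <= G1 z by rewrite !mulr_ge0.
have G20 z : 0 <= G2 z by rewrite !mulr_ge0.
have G30 z : 0 <= G3 z by rewrite !mulr_ge0.
transitivity (\int[mu]_x \int[mu]_y (\1[0 < x] * G1 (x, y))%:E +
   \int[mu]_x \int[mu]_y (\1[0 < x] * G3 (x, y))%:E)%E.
  transitivity (\int[mu]_x \int[mu]_y
    (\1[0 < x] * G1 (x, y) + \1[0 < y] * G2 (y, x))%:E)%E.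
    apply: eq_integral => x _; apply: eq_integral => y _; congr EFin.
    rewrite /G1 /G2 /=.
    by have [x0|x0] := ltP 0 x; have [y0|y0] := ltP 0 y; have [xy|xy] := ltP y x;
      rewrite ?(mul0r, mul1r, mulr0, addr0, add0r).
  etransitivity.
    apply: (ge0_integral2D (fun z => \1[0 < z.1] * G1 (z.1, z.2))
      (fun z => \1[0 < z.2] * G2 (z.2, z.1))).
    - by meas.
    - by meas.
    - by move=> z; rewrite mulr_ge0.
    - by move=> z; rewrite mulr_ge0.
  congr (_ + _)%E.
  etransitivity.
    apply: (tonelli_swap (fun z => \1[0 < z.2] * G2 (z.2, z.1))).
      by meas.
    by move=> z; rewrite mulr_ge0.
  (* For fixed [y], [G2] and [G3] differ at most at [x = y]. *)
  apply: eq_integral => y _; apply: (ge0_ae_eq_integral_neq y).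
  - by meas.
  - by meas.
  - by move=> x; rewrite lee_fin mulr_ge0.
  - by move=> x; rewrite lee_fin mulr_ge0.
  - by move=> x xy; rewrite /G2 /G3 /= le_eqVlt (negbTE xy).
transitivity (\int[mu]_s \int[mu]_w (\1[0 < s] * (s * G1 (s, s * w)))%:E +
   \int[mu]_s \int[mu]_w (\1[0 < s] * (s * G3 (s, s * w)))%:E)%E.
  by rewrite (ge0_integral_scale G1 mG1 G10) (ge0_integral_scale G3 mG3 G30).
etransitivity.
  apply/esym/(ge0_integral2D (fun z => \1[0 < z.1] * (z.1 * G1 (z.1, z.1 * z.2)))
    (fun z => \1[0 < z.1] * (z.1 * G3 (z.1, z.1 * z.2)))).
  - by meas.
  - by meas.
  - by move=> z; have [z0|z0] := ltP 0 z.1; rewrite ?mul0r// !mulr_ge0// ltW.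
  - by move=> z; have [z0|z0] := ltP 0 z.1; rewrite ?mul0r// !mulr_ge0// ltW.
apply: eq_integral => s _; apply: eq_integral => w _; congr EFin.
have [s0|] := ltP 0 s; last by rewrite !mul0r addr0.
rewrite /G1 /G3 /= pmulr_rgt0// (_ : (s * w < s) = (w < 1)); first by ring.
by rewrite -subr_gt0 -[RHS]subr_gt0 -(pmulr_rgt0 (1 - w) s0); congr (_ < _); ring.
Qed.

Lemma measurable_funV_gt0 (rho : MR -> R) :
  measurable_fun setT rho -> (forall w, 0 < rho w) ->
  measurable_fun setT (fun w => (rho w)^-1).
Proof.
move=> mrho rho0; rewrite (_ : (fun _ => _) = (@powR R ^~ (-1)) \o rho).
  by apply: measurableT_comp => //; exact: measurable_powR.
by apply/funext => w /=; rewrite powR_inv1// ltW.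
Qed.

(** Tonelli brings [w] outside; at fixed [w], the substitution [t = s * rho w] turns [s ds] into
    [(rho w)^-1 ^+ 2 * t dt]; Tonelli again brings [t] outside. Here [chi] is a test function of the
    distance and [phi] the profile along rays. *)
Lemma ge0_integral_radial (rho : MR -> R) (phi : MR -> R) :
  measurable_fun setT rho -> (forall w, 0 < rho w) ->
  measurable_fun setT phi -> (forall s, 0 <= phi s) ->
  forall chi : MR -> R, measurable_fun setT chi -> (forall t, 0 <= chi t) ->
  (\int[mu]_s \int[mu]_w (\1[0 < s] * (\1[0 < w] * \1[w < 1] *
     (s * (chi (s * rho w)%R * phi s))))%:E =
   \int[mu]_t ((\1[0 < t] * t * chi t)%:E * \int[mu]_w (\1[0 < w] * \1[w < 1] *
     ((rho w)^-1 ^+ 2 * phi (t / rho w)))%:E))%E.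
Proof.
move=> mrho rho0 mphi phi0 chi mchi chi0.
have mrhoV := measurable_funV_gt0 rho mrho rho0.
have F0 s : 0 <= \1[0 < s] * s :> R.
  by have [s0|s0] := ltP 0 s; rewrite ?mul0r// mul1r ltW.
pose F1 z := \1[0 < z.1] * (\1[0 < z.2] * \1[z.2 < 1] *
     (z.1 * (chi (z.1 * rho z.2)%R * phi z.1))).
have F10 z : 0 <= F1 z.
  rewrite /F1 (_ : _ * _ = (\1[0 < z.1] * z.1) * (\1[0 < z.2] * \1[z.2 < 1] *
     (chi (z.1 * rho z.2)%R * phi z.1))); last by ring.
  by rewrite mulr_ge0// !mulr_ge0.
have mF1 : measurable_fun setT (F1 : MR * MR -> R) by rewrite /F1; meas.
etransitivity; first exact: (tonelli_swap F1).
pose F2 z := \1[0 < z.1] * z.1 * chi z.1 * (\1[0 < z.2] * \1[z.2 < 1] *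
     (((rho z.2)^-1) ^+ 2 * phi (z.1 / rho z.2))).
have F20 z : 0 <= F2 z.
  rewrite /F2 mulr_ge0//; first by rewrite mulr_ge0.
  by rewrite mulr_ge0// mulr_ge0// sqr_ge0.
have mF2 : measurable_fun setT (F2 : MR * MR -> R).
  by rewrite /F2; meas.
transitivity (\int[mu]_w \int[mu]_t (F2 (t, w))%:E)%E.
  apply: eq_integral => w _; have r0 := rho0 w.
  have rV0 : (rho w)^-1 != 0 by rewrite gt_eqF// invr_gt0.
  rewrite (ge0_integral_affine _ (rho w)^-1 0)//; last 2 first.
  - by meas.
  - by move=> s; rewrite lee_fin.
  rewrite -ge0_integralZl_EFin//=; last 2 first.
  - by move=> s _; rewrite lee_fin.
  - by meas.
  apply: eq_integral => t _; rewrite -EFinM; congr EFin; rewrite /F1 /F2 /=.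
  rewrite addr0 [_^-1 * t]mulrC pmulr_lgt0 ?invr_gt0// gtr0_norm ?invr_gt0//.
  by rewrite divfK ?gt_eqF//; ring.
etransitivity; first exact/esym/(tonelli_swap F2).
apply: eq_integral => t _.
rewrite -ge0_integralZl_EFin//=.
- by move=> w _; rewrite lee_fin mulr_ge0// mulr_ge0// sqr_ge0.
- by meas.
- by rewrite mulr_ge0.
Qed.

End plane.

(** * The covariogram of the triangle *)

Lemma integral_itv_is_derive (R : realType) (f F : R -> R) (u v : R) :
  u <= v -> (forall x : R, is_derive x 1 F (f x)) -> continuous f ->
  (\int[@lebesgue_measure R]_(x in `[u, v]) (f x)%:E = (F v - F u)%:E)%E.
Proof.
rewrite le_eqVlt => /predU1P[<- _ _|uv dF cf].
  by rewrite set_itv1 integral_set1 subrr.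
have cF (x : R) : {for x, continuous F}.
  apply: differentiable_continuous; apply/derivable1_diffP.
  by have [] := dF x.
rewrite (@continuous_FTC2 _ f F)//.
- exact: continuous_subspaceT.
- split=> [x _||]; first by have [] := dF x.
    by apply: cvg_at_right_filter; exact: cF.
  by apply: cvg_at_left_filter; exact: cF.
- by move=> x _; rewrite derive1E; have [] := dF x.
Qed.

Section covariogram.
Variables (R : realType) (a b : R).
Hypotheses (a_gt0 : 0 < a) (b_gt0 : 0 < b).
Notation mu := (@lebesgue_measure R).
Notation MR := (measurableTypeR R).
Notation T := (right_triangle a b).

Lemma right_triangleE : T = [set z | [/\ 0 <= z.1, 0 <= z.2 & z.1 / a + z.2 / b <= 1]].
Proof.
apply/seteqP; split=> [_ [k [l [m [k0 l0 m0 klm] ->]]]|[x y]] /=.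
  rewrite !mulr0 !addr0 add0r /=; split; [exact/mulr_ge0/ltW|exact/mulr_ge0/ltW|].
  by rewrite !mulfK ?gt_eqF// -klm; lra.
(* The barycentric coordinates of [(x, y)]. *)
move=> [x0 y0 xy]; exists (y / b), (x / a), (1 - (x / a + y / b)); split.
- exact/divr_ge0/ltW.
- exact/divr_ge0/ltW.
- by rewrite subr_ge0.
- by ring.
- by rewrite !mulr0 !addr0 add0r !divfK ?gt_eqF.
Qed.

Definition tri (z : MR * MR) : R :=
  \1[0 <= z.1] * \1[0 <= z.2] * \1[z.1 / a + z.2 / b <= 1].

Lemma measurable_tri : measurable_fun setT tri.
Proof. by rewrite /tri; meas. Qed.

Lemma indic_right_triangle : \1_T = tri.
Proof.
apply/funext => z; rewrite indicE /tri -!natrM !mulnb; congr (nat_of_bool _)%:R.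
apply/idP/idP; first by rewrite inE right_triangleE => -[-> -> ->].
by move=> /andP[/andP[? ?] ?]; rewrite inE right_triangleE.
Qed.

Lemma measurable_right_triangle : measurable (T : set (MR * MR)).
Proof.
apply/(measurable_indicP R); rewrite indic_right_triangle; exact: measurable_tri.
Qed.

(** Up to scale, [m - x] is the length of the vertical section of a right triangle at abscissa [x];
    the triangle is empty for [m < 0]. *)
Lemma integral_ramp (m : R) :
  (\int[mu]_x (\1[0 <= x] * Num.max 0 (m - x))%:E = (Num.max 0 m ^+ 2 / 2)%:E)%E.
Proof.
have [m0|m0] := leP m 0.
  rewrite expr0n/= mul0r; apply: integral0_eq => x _; congr EFin.
  have [x0|] := leP 0 x; last by rewrite mul0r.
  by rewrite (max_idPl _) ?mulr0//; lra.
transitivity (\int[mu]_(x in `[0%R, m]) (m - x)%:E)%E.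
  rewrite [RHS]integral_mkcond; apply: eq_integral => x _.
  rewrite patchE mem_setE in_itv/=.
  have [x0|] := leP 0 x; last by rewrite mul0r.
  have [xm|xm] /= := leP x m; rewrite mul1r.
    by rewrite (max_idPr _)// subr_ge0.
  by rewrite (max_idPl _)// subr_le0 ltW.
have dF (x : R) : is_derive x 1 (fun x : R => m * x - x ^+ 2 / 2) (m - x).
  apply: is_derive_eq.
  by rewrite /GRing.scale/=; field.
rewrite (integral_itv_is_derive _ _ _ _ _ (ltW m0) dF).
  by congr EFin; field.
by move=> x; apply: cvgB => //; exact: cvg_cst.
Qed.


(* When nonnegative, the homothety ratio from T to its intersection with T - v;
   it equals 1 - N v. *)
Definition overlap (v : MR * MR) : R :=
  Num.min 1 (1 - (v.1 / a + v.2 / b)) - Num.max 0 (- v.1) / a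
  - Num.max 0 (- v.2) / b.

Lemma natr_andb (c e : bool) : (c%:R * e%:R : R) = (c && e)%:R.
Proof. by rewrite -natrM mulnb. Qed.

(** The intersection is again a right triangle, with legs [a * overlap v] and [b * overlap v], or
    empty when the overlap is negative; the lengths of its vertical sections are integrated. *)
Lemma covariogram (v : MR * MR) :
  (\int[mu]_x \int[mu]_y (tri (x, y) * tri ((x + v.1)%R, (y + v.2)%R))%:E =
   (area a b * Num.max 0 (overlap v) ^+ 2)%:E)%E.
Proof.
(* The corner of the intersection, and the level of its hypotenuse for [x / a + y / b]. *)
pose x0 := Num.max 0 (- v.1); pose y0 := Num.max 0 (- v.2).
pose k := Num.min 1 (1 - (v.1 / a + v.2 / b)).
have b0 := gt_eqF b_gt0; have a0 := gt_eqF a_gt0.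
transitivity (\int[mu]_x (\1[x0 <= x] * Num.max 0 (b * (k - x / a) - y0))%:E)%E.
  apply: eq_integral => x _.
  transitivity (\int[mu]_y (\1[x0 <= x] * \1_(`[y0, b * (k - x / a)]) y)%:E)%E.
    apply: eq_integral => y _; congr EFin.
    rewrite indicE mem_setE in_itv/= /tri/= !natr_andb; congr (nat_of_bool _)%:R.
    have -> : (y <= b * (k - x / a)) = (x / a + y / b <= k).
      rewrite -ler_pdivrMl// lerBrDl.
      by rewrite [b^-1 * _]mulrC.
    rewrite /x0 /y0 /k !ge_max le_min.
    have -> : (0 <= x + v.1) = (- v.1 <= x) by rewrite -lerBlDr sub0r.
    have -> : (0 <= y + v.2) = (- v.2 <= y) by rewrite -lerBlDr sub0r.
    have -> : ((x + v.1) / a + (y + v.2) / b <= 1) =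
       (x / a + y / b <= 1 - (v.1 / a + v.2 / b)).
      by rewrite lerBrDr !mulrDl addrACA.
    by do ![case: (_ <= _)].
  under eq_integral do rewrite EFinM.
  rewrite ge0_integralZl_EFin//; last exact/measurable_EFinP/measurable_indic.
  rewrite integral_indic// setIT EFinM; congr (_ * _)%E.
  rewrite /= lebesgue_measure_itv/= lte_fin; case: ltP => [h|h].
    by rewrite (max_idPr _) ?EFinB// subr_ge0 ltW.
  by rewrite (max_idPl _)// subr_le0.
(* Moves the corner to abscissa 0 and normalises the leg [a]. *)
rewrite (ge0_integral_affine _ a x0) ?a0//; last 2 first.
- by meas.
- by move=> x; rewrite lee_fin mulr_ge0// le_max lexx.
transitivity (a%:E * \int[mu]_x (b%:E * (\1[0 <= x] * Num.max 0 (overlap v - x))%:E))%E.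
  rewrite gtr0_norm//; congr (_ * _)%E; apply: eq_integral => x _.
  rewrite -EFinM; congr EFin.
  have bmax (u : R) : b * Num.max 0 u = Num.max 0 (b * u).
    by rewrite maxr_pMr ?mulr0// ltW.
  rewrite [RHS]mulrCA bmax.
  rewrite lerDr pmulr_rge0//.
  suff -> : b * (k - (a * x + x0) / a) - y0 = b * (overlap v - x) by [].
  by rewrite /overlap -/x0 -/y0 -/k; field; rewrite a0 b0.
rewrite ge0_integralZl_EFin ?ltW//; last 2 first.
- by move=> x _; rewrite lee_fin mulr_ge0// le_max lexx.
- by meas.
by rewrite integral_ramp -!EFinM; congr EFin; rewrite /area; field.
Qed.

End covariogram.

(** * The joint law *)

(* The library does not infer a sigma-finite structure on [m1 \x m2]: the key is
   taken by the instance for products of subprobabilities. *)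
Section lebesgue_measure2.
Variable R : realType.

HB.instance Definition _ := Measure.on (@lebesgue_measure2 R).

Let lebesgue_measure2_sigma_finite :
  sigma_finite setT (@lebesgue_measure2 R).
Proof.
pose I (n : nat) : set R := `[- n%:R, n%:R]%classic.
exists (fun n => I n `*` I n) => [|n].
  apply/seteqP; split => // -[x y] _.
  have le_bound (z : R) n : (Num.trunc `|z| < n)%N -> I n z.
    move=> zn; rewrite /I /= in_itv/= -ler_norml ltW//.
    by rewrite (lt_le_trans (truncnS_gt _))// ler_nat.
  exists (maxn (Num.trunc `|x|) (Num.trunc `|y|)).+1 => //.
  by split; apply: le_bound; rewrite ltnS ?leq_maxl ?leq_maxr.
have mI : measurable (I n) by exact: measurable_itv.
split; first exact: measurableX.
have muI : (@lebesgue_measure R (I n) < +oo)%E.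
  by rewrite lebesgue_measure_itv; case: ifP => // _; rewrite -EFinB ltry.
by rewrite /lebesgue_measure2 product_measure1E// lte_mul_pinfty// ge0_fin_numE.
Qed.

HB.instance Definition _ := Measure_isSigmaFinite.Build _ _ _
  (@lebesgue_measure2 R) lebesgue_measure2_sigma_finite.

End lebesgue_measure2.

Section joint.
Variables (R : realType) (d : measure_display) (Omega : measurableType d).
Variables (P : probability Omega R).
Notation mu := (@lebesgue_measure R).
Notation MR := (measurableTypeR R).
Notation mu2 := (@lebesgue_measure2 R).

Lemma ge0_integral_shift2 (v : MR * MR) (f : MR * MR -> R) :
  measurable_fun setT f -> (forall z, 0 <= f z) ->
  (\int[mu2]_z (f z)%:E = \int[mu2]_z (f ((z.1 + v.1)%R, (z.2 + v.2)%R))%:E)%E.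
Proof.
move=> mf f0.
have mF : measurable_fun setT (EFin \o f) by exact/measurable_EFinP.
etransitivity.
  by apply: (fubini_tonelli1 (EFin \o f)) => // z; rewrite lee_fin.
etransitivity; last first.
  symmetry; apply: (fubini_tonelli1 (fun z : MR * MR =>
    (f ((z.1 + v.1)%R, (z.2 + v.2)%R))%:E)).
    by meas.
  by move=> z; rewrite lee_fin.
rewrite /fubini_F /=.
rewrite (ge0_integral_affine _ 1 v.1 (fun x => \int[mu]_y (f (x, y))%:E)%E) ?oner_eq0//.
- rewrite normr1 mul1e; apply: eq_integral => x _; rewrite mul1r.
  rewrite (ge0_integral_affine _ 1 v.2) ?oner_eq0//.
  + by rewrite normr1 mul1e; apply: eq_integral => y _; rewrite mul1r.
  + by meas.
  + by move=> y; rewrite lee_fin.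
- exact: (measurable_fun_fubini_tonelli_F (EFin \o f)).
- by move=> x; apply: integral_ge0 => y _; rewrite lee_fin.
Qed.

(** Uniqueness of product measures serves twice, each time tested on rectangles: independence makes
    the joint law the product of the marginals, and this product is the restricted Lebesgue measure
    divided by [m ^+ 2]. *)
Lemma uniform_joint_law (X Y : {RV P >-> (MR * MR)%type}) (S : set (MR * MR)) (m : R)
    (E : set ((MR * MR) * (MR * MR))) :
  uniform_on X S -> uniform_on Y S -> independent_RVs X Y ->
  measurable S -> 0 < m -> mu2 S = m%:E -> measurable E ->
  P ((fun w => (X w, Y w)) @^-1` E) =
  ((m^-1 ^+ 2)%:E * (mu2 \x mu2)%E (E `&` (S `*` S)))%E.
Proof.
move=> uX uY XY mS m0 mu2S mE.
have mXY : measurable_fun setT (fun w => (X w, Y w)).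
  by apply: measurable_fun_pair; exact: measurable_funPT.
have mSS : measurable (S `*` S) by exact: measurableX.
have k0 : 0 <= m^-1 ^+ 2 by exact: sqr_ge0.
have uE (Z : {RV P >-> (MR * MR)%type}) : uniform_on Z S -> forall B, measurable B ->
    distribution P Z B = (mu2 (B `&` S) * m^-1%:E)%E.
  by move=> uZ B mB; rewrite uZ// [in X in (_ / X)%E]mu2S inver gt_eqF.
transitivity ((distribution P X \x distribution P Y)%E E).
  apply/esym.
  transitivity (pushforward P (fun w => (X w, Y w)) E) => //.
  exact: product_measure_unique.
transitivity (mscale (NngNum k0) (mrestr (mu2 \x mu2)%E mSS) E) => //.
apply: product_measure_unique => // A B mA mB.
rewrite -[RHS]/(distribution P X A * distribution P Y B)%E !uE//.
transitivity ((m^-1 ^+ 2)%:E * (mu2 \x mu2) ((A `*` B) `&` (S `*` S)))%E => //.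
rewrite -setXI product_measure1E; [|exact: measurableI|exact: measurableI].
by rewrite muleACA -EFinM muleC -expr2.
Qed.

End joint.

(** * The law of the distance as a radial integral *)

Section law.
Variables (R : realType) (a b : R).
Hypotheses (a_gt0 : 0 < a) (b_gt0 : 0 < b).
Notation mu := (@lebesgue_measure R).
Notation MR := (measurableTypeR R).
Notation mu2 := (@lebesgue_measure2 R).
Notation T := (right_triangle a b).
Notation tri := (tri R a b).
Notation overlap := (overlap R a b).

(** The contribution of one side, up to the factor [t] and a constant. It takes extended real
    values: finiteness only comes with the closed form [strip]. *)
Definition radial (rho : MR -> R) (t : MR) : \bar R :=
  (\int[mu]_w (\1[0 < w] * \1[w < 1] *
     ((rho w)^-1 ^+ 2 * Num.max 0 (1 - t / rho w) ^+ 2))%:E)%E.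

(* The distance from the origin to the point of parameter w on the sides
   x / a + y / b = 1, - x / a = 1 and y / b = 1 of the unit ball of N. *)
Definition edge1 (w : MR) : R := Num.sqrt ((a * w) ^+ 2 + (b * (1 - w)) ^+ 2).
Definition edge2 (w : MR) : R := Num.sqrt (a ^+ 2 + (b * w) ^+ 2).
Definition edge3 (w : MR) : R := Num.sqrt ((a * w) ^+ 2 + b ^+ 2).

Let measurable_sqrt : measurable_fun [set: MR] (@Num.sqrt R).
Proof. apply: continuous_measurable_fun; exact: sqrt_continuous. Qed.

Lemma measurable_edge1 : measurable_fun setT edge1.
Proof. by rewrite /edge1; meas. Qed.
Lemma measurable_edge2 : measurable_fun setT edge2.
Proof. by rewrite /edge2; meas. Qed.
Lemma measurable_edge3 : measurable_fun setT edge3.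
Proof. by rewrite /edge3; meas. Qed.

Lemma edge1_gt0 w : 0 < edge1 w.
Proof.
rewrite sqrtr_gt0; have [->|w0] := eqVneq w 0.
  by rewrite mulr0 subr0 mulr1 expr0n add0r exprn_gt0.
by rewrite ltr_pwDl ?sqr_ge0// exprn_even_gt0//= mulf_neq0// gt_eqF.
Qed.

Lemma edge2_gt0 w : 0 < edge2 w.
Proof. by rewrite sqrtr_gt0 ltr_pwDl ?sqr_ge0 ?exprn_gt0. Qed.

Lemma edge3_gt0 w : 0 < edge3 w.
Proof. by rewrite sqrtr_gt0 ltr_wpDl ?sqr_ge0 ?exprn_gt0. Qed.

Let nrm (v : MR * MR) : R := Num.sqrt (v.1 ^+ 2 + v.2 ^+ 2).

Let measurable_nrm : measurable_fun setT nrm.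
Proof. by rewrite /nrm; meas. Qed.

Let measurable_tri := measurable_tri R a b.

Lemma measurable_overlap : measurable_fun setT overlap.
Proof. by rewrite /overlap; meas. Qed.

Lemma tri_ge0 z : 0 <= tri z.
Proof. by rewrite /tri !mulr_ge0. Qed.

(** The intersections of the triangle with its translates by [v] and by [- v] are translates of each
    other. *)
Lemma overlapN v : overlap (- v.1, - v.2) = overlap v.
Proof.
rewrite /overlap /= !opprK !mulNr.
have maxN (x : R) : Num.max 0 x = x + Num.max 0 (- x).
  by case: (lerP 0 x) => x0; [rewrite (max_idPl _)|rewrite (max_idPr _)]; lra.
rewrite (maxN v.1) (maxN v.2) !mulrDl.
set p := v.1 / a; set q := v.2 / b.
by rewrite /Order.min; case: ltP => ?; case: ltP => ?; lra.
Qed.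

(** With [q = p + v] the distance depends on [v] alone; integrating over [p] first leaves the
    covariogram. *)
Lemma integral_triangle_pairs (chi : MR -> R) : measurable_fun setT chi ->
  (forall t, 0 <= chi t) ->
  (\int[mu2]_p \int[mu2]_q (chi (euclidean_dist p q) * (tri p * tri q))%:E =
   \int[mu2]_v (chi (nrm v) * (area a b * Num.max 0 (overlap v) ^+ 2))%:E)%E.
Proof.
move=> mchi chi0; have tri0 := tri_ge0.
have mnrm := measurable_nrm; have mtri := measurable_tri.
have msq := measurable_sqrt.
transitivity (\int[mu2]_p \int[mu2]_v
    (chi (nrm v) * (tri p * tri (p.1 + v.1, p.2 + v.2)%R))%:E)%E.
  apply: eq_integral => p _; etransitivity.
    apply: (ge0_integral_shift2 _ p
      (fun q => chi (euclidean_dist p q) * (tri p * tri q))).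
      by rewrite /euclidean_dist; meas.
    by move=> z; rewrite !mulr_ge0.
  apply: eq_integral => v _; congr EFin; rewrite /=.
  congr (chi (Num.sqrt _) * (_ * tri (_, _))); last 2 first.
  - by rewrite addrC.
  - by rewrite addrC.
  by rewrite /=; ring.
etransitivity.
  apply: (fubini_tonelli (m1 := mu2) (m2 := mu2) (fun z : (MR * MR) * (MR * MR) =>
    (chi (nrm z.2) * (tri z.1 * tri (z.1.1 + z.2.1, z.1.2 + z.2.2)%R))%:E)).
    by meas.
  by move=> z; rewrite lee_fin !mulr_ge0.
apply: eq_integral => v _; rewrite /=.
under eq_integral do rewrite EFinM.
rewrite ge0_integralZl_EFin//; last 2 first.
- by move=> p _; rewrite lee_fin mulr_ge0.
- by meas.
rewrite EFinM; congr (_ * _)%E.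
rewrite -(covariogram R a b a_gt0 b_gt0).
apply: (fubini_tonelli1 (m1 := mu) (m2 := mu)
  (fun p : MR * MR => (tri p * tri (p.1 + v.1, p.2 + v.2)%R)%:E)).
  by meas.
by move=> z; rewrite lee_fin mulr_ge0.
Qed.

Lemma area_gt0 : 0 < area a b.
Proof. by rewrite divr_gt0// mulr_gt0. Qed.

(** The covariogram at [v = 0]. *)
Lemma lebesgue_measure2_right_triangle : mu2 T = (area a b)%:E.
Proof.
have mtri := measurable_tri; have tri0 := tri_ge0.
rewrite -[LHS]mul1e -[T]setIT -integral_indic//; last exact: measurable_right_triangle.
rewrite mul1e.
transitivity (area a b * Num.max 0 (overlap (0, 0)) ^+ 2)%:E; last first.
  by rewrite /overlap/= oppr0 maxxx !mul0r addr0 !subr0 minxx (max_idPr _)// expr1n mulr1.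
rewrite -(covariogram R a b a_gt0 b_gt0).
etransitivity.
  apply: (fubini_tonelli1 (m1 := mu) (m2 := mu) (fun p : MR * MR => (\1_T p)%:E)).
    rewrite indic_right_triangle//; by meas.
  by move=> z; rewrite lee_fin.
apply: eq_integral => x _; apply: eq_integral => y _; congr EFin.
by rewrite indic_right_triangle// !addr0 /tri !natr_andb andbb.
Qed.


Let phi (s : MR) : R := Num.max 0 (1 - s) ^+ 2.
Let measurable_phi : measurable_fun setT phi.
Proof. by rewrite /phi; meas. Qed.
Let phi_ge0 s : 0 <= phi s. Proof. exact: sqr_ge0. Qed.

Lemma measurable_radial_integrand (rho : MR -> R) t : measurable_fun setT rho ->
  (forall w, 0 < rho w) ->
  measurable_fun setT (fun w : MR => (\1[0 < w] * \1[w < 1] *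
     ((rho w)^-1 ^+ 2 * Num.max 0 (1 - t / rho w) ^+ 2))%:E).
Proof.
by move=> mrho rho0; have mrhoV := measurable_funV_gt0 _ _ mrho rho0; meas.
Qed.

Lemma measurable_radial (rho : MR -> R) : measurable_fun setT rho ->
  (forall w, 0 < rho w) -> measurable_fun setT (radial rho).
Proof.
move=> mrho rho0; have mrhoV := measurable_funV_gt0 _ _ mrho rho0.
apply: (measurable_fun_fubini_tonelli_F (m2 := mu) (fun z : MR * MR =>
  (\1[0 < z.2] * \1[z.2 < 1] *
   ((rho z.2)^-1 ^+ 2 * Num.max 0 (1 - z.1 / rho z.2) ^+ 2))%:E)).
  by meas.
by move=> z; rewrite lee_fin mulr_ge0// mulr_ge0// sqr_ge0.
Qed.

Lemma radial_ge0 (rho : MR -> R) t : (0 <= radial rho t)%E.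
Proof.
apply: integral_ge0 => w _; rewrite lee_fin.
by rewrite mulr_ge0// mulr_ge0// sqr_ge0.
Qed.

(** Central symmetry leaves two quadrants. Where [x] and [y] have the same sign, the unit ball has
    the single side of [edge1]; where the signs differ, it has a corner and the sides of [edge2] and
    [edge3]. *)
Lemma integral_sectors (chi : MR -> R) : measurable_fun setT chi ->
  (forall t, 0 <= chi t) ->
  (\int[mu]_x \int[mu]_y (chi (nrm (x, y)) * Num.max 0 (overlap (x, y)) ^+ 2)%:E =
   (a * b)%:E * \int[mu]_t ((\1[0 < t] * t * (2 * chi t))%:E *
     (radial edge1 t + radial edge2 t + radial edge3 t)))%E.
Proof.
move=> mchi chi0.
have mnrm := measurable_nrm; have mov := measurable_overlap.
have me1 := measurable_edge1; have me2 := measurable_edge2.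
have me3 := measurable_edge3; have mphi := measurable_phi.
pose F (v : MR * MR) := chi (nrm v) * Num.max 0 (overlap v) ^+ 2.
have mF : measurable_fun setT F by rewrite /F; meas.
have F0 v : 0 <= F v by rewrite mulr_ge0// sqr_ge0.
have FN x y : F (- x, - y) = F (x, y).
  by rewrite /F /nrm (overlapN (x, y))/= !sqrrN.
etransitivity; first exact: (ge0_integral_plane _ F).
etransitivity.
  apply: (ge0_integral_dilation2 _ a b (fun z => \1[0 < z.1] * \1[0 < z.2] *
    (2 * (F (z.1, z.2) + F (- z.1, z.2))))) => //.
    by meas.
  by move=> z; rewrite mulr_ge0// mulr_ge0// addr_ge0.
congr (_ * _)%E.
pose G1 (z : MR * MR) := 2 * F (a * z.1, b * z.2).
pose G2 (z : MR * MR) := 2 * F (- (a * z.1), b * z.2).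
have mG1 : measurable_fun setT G1 by rewrite /G1; meas.
have mG2 : measurable_fun setT G2 by rewrite /G2; meas.
have G10 z : 0 <= G1 z by rewrite mulr_ge0.
have G20 z : 0 <= G2 z by rewrite mulr_ge0.
pose chi2 t := 2 * chi t.
have mchi2 : measurable_fun setT chi2 by rewrite /chi2; meas.
have chi20 t : 0 <= chi2 t by rewrite mulr_ge0.
pose sect (rho : MR -> R) (z : MR * MR) : R :=
  \1[0 < z.1] * (\1[0 < z.2] * \1[z.2 < 1] *
     (z.1 * (chi2 (z.1 * rho z.2)%R * phi z.1))).
have sect0 rho z : 0 <= sect rho z.
  rewrite /sect; have [z0|z0] := ltP 0 z.1; last by rewrite mul0r.
  by rewrite mul1r mulr_ge0// mulr_ge0 ?(ltW z0)// mulr_ge0.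
have msect rho : measurable_fun setT rho -> measurable_fun setT (sect rho).
  by move=> mrho; rewrite /sect; meas.
transitivity (\int[mu]_s \int[mu]_w (sect edge1 (s, w))%:E +
   (\int[mu]_s \int[mu]_w (sect edge2 (s, w))%:E +
    \int[mu]_s \int[mu]_w (sect edge3 (s, w))%:E))%E.
  transitivity (\int[mu]_x \int[mu]_y (\1[0 < x] * \1[0 < y] * G1 (x, y))%:E +
     \int[mu]_x \int[mu]_y (\1[0 < x] * \1[0 < y] * G2 (x, y))%:E)%E.
    rewrite -(ge0_integral2D _ (fun z => \1[0 < z.1] * \1[0 < z.2] * G1 (z.1, z.2))
      (fun z => \1[0 < z.1] * \1[0 < z.2] * G2 (z.1, z.2))).
    - apply: eq_integral => x _; apply: eq_integral => y _; congr EFin.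
      by rewrite /G1 /G2 /= !pmulr_rgt0//; ring.
    - by meas.
    - by meas.
    - by move=> z; rewrite mulr_ge0.
    - by move=> z; rewrite mulr_ge0.
  have sqrt_scale (s u : R) : 0 < s -> Num.sqrt (s ^+ 2 * u) = s * Num.sqrt u.
    by move=> s0; rewrite sqrtrM ?sqr_ge0// sqrtr_sqr gtr0_norm.
  have EG1 : (\int[mu]_x \int[mu]_y (\1[0 < x] * \1[0 < y] * G1 (x, y))%:E =
      \int[mu]_s \int[mu]_w (sect edge1 (s, w))%:E)%E.
    etransitivity; first exact: (ge0_integral_quadrant_sum _ G1).
    apply: eq_integral => s _; apply: eq_integral => w _; congr EFin.
    rewrite /sect /=; have [s0|s0] := ltP 0 s; last by rewrite !mul0r.
    have [w0|w0] := ltP 0 w; last by rewrite !(mul0r, mulr0).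
    have [w1|w1] := ltP w 1; last by rewrite !(mul0r, mulr0).
    have sw0 : 0 < s * w by rewrite mulr_gt0.
    have sw1 : 0 < s * (1 - w) by rewrite mulr_gt0 ?subr_gt0.
    rewrite /G1 /chi2 /F /phi.
    have -> : nrm (a * (s * w), b * (s * (1 - w))) = s * edge1 w.
      by rewrite /nrm /edge1 -sqrt_scale//=; congr Num.sqrt; ring.
    (* On each of the three cones [s] is the gauge [N] of the point, so the overlap is [1 - s]. *)
    have -> : overlap (a * (s * w), b * (s * (1 - w))) = 1 - s.
      rewrite /overlap /= (max_idPl _); last by rewrite oppr_le0 mulr_ge0 ?ltW.
      rewrite (max_idPl _); last by rewrite oppr_le0 mulr_ge0 ?ltW.
      rewrite !mul0r !subr0 [a * _]mulrC [b * _]mulrC !mulfK ?gt_eqF//.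
      by rewrite (min_idPr _); lra.
    by ring.
  rewrite EG1; congr adde.
  etransitivity; first exact: (ge0_integral_quadrant_max _ G2).
  etransitivity; last first.
    apply: (ge0_integral2D _ (sect edge2) (sect edge3)).
    - exact: msect.
    - exact: msect.
    - by [].
    - by [].
  apply: eq_integral => s _; apply: eq_integral => w _; congr EFin.
  rewrite /sect /=; have [s0|s0] := ltP 0 s; last by rewrite !mul0r addr0.
  have [w0|w0] := ltP 0 w; last by rewrite !(mul0r, mulr0) addr0.
  have [w1|w1] := ltP w 1; last by rewrite !(mul0r, mulr0) addr0.
  have sw0 : 0 < s * w by rewrite mulr_gt0.
  have sw1 : 0 < s * (1 - w) by rewrite mulr_gt0 ?subr_gt0.
  rewrite /G2 /chi2 /F /phi.
  have -> : nrm (- (a * s), b * (s * w)) = s * edge2 w.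
    by rewrite /nrm /edge2 -sqrt_scale//=; congr Num.sqrt; ring.
  have -> : nrm (- (a * (s * w)), b * s) = s * edge3 w.
    by rewrite /nrm /edge3 -sqrt_scale//=; congr Num.sqrt; ring.
  have -> : overlap (- (a * s), b * (s * w)) = 1 - s.
    rewrite /overlap /= opprK (max_idPr _); last by rewrite mulr_ge0 ?ltW.
    rewrite (max_idPl _); last by rewrite oppr_le0 mulr_ge0 ?ltW.
    rewrite mul0r subr0 mulNr [a * _]mulrC [b * _]mulrC !mulfK ?gt_eqF//.
    by rewrite (min_idPl _); lra.
  have -> : overlap (- (a * (s * w)), b * s) = 1 - s.
    rewrite /overlap /= opprK (max_idPr _); last by rewrite mulr_ge0 ?ltW.
    rewrite (max_idPl _); last by rewrite oppr_le0 mulr_ge0 ?ltW.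
    rewrite mul0r subr0 mulNr [a * _]mulrC [b * _]mulrC !mulfK ?gt_eqF//.
    by rewrite (min_idPr _); lra.
  by ring.
have radialE (rho : MR -> R) : measurable_fun setT rho -> (forall w, 0 < rho w) ->
    (\int[mu]_s \int[mu]_w (sect rho (s, w))%:E =
     \int[mu]_t ((\1[0 < t] * t * chi2 t)%:E * radial rho t))%E.
  by move=> mrho rho0; exact: (ge0_integral_radial _ rho phi).
have c0 t : 0 <= \1[0 < t] * t * chi2 t.
  by have [t0|t0] := ltP 0 t; rewrite ?mul0r// mul1r mulr_ge0// ltW.
have rad0 rho t : (0 <= (\1[0 < t] * t * chi2 t)%:E * radial rho t)%E.
  by rewrite mule_ge0 ?lee_fin// radial_ge0.
have mrad (rho : MR -> R) : measurable_fun setT rho -> (forall w, 0 < rho w) ->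
    measurable_fun setT (fun t : MR => (\1[0 < t] * t * chi2 t)%:E * radial rho t)%E.
  move=> mrho rho0; apply: emeasurable_funM; last exact: measurable_radial.
  by meas.
have e1 := edge1_gt0; have e2 := edge2_gt0; have e3 := edge3_gt0.
etransitivity.
  exact: (congr2 adde (radialE _ me1 e1)
    (congr2 adde (radialE _ me2 e2) (radialE _ me3 e3))).
pose f (rho : MR -> R) (t : MR) := ((\1[0 < t] * t * chi2 t)%:E * radial rho t)%E.
transitivity (\int[mu]_t (f edge1 t + (f edge2 t + f edge3 t)))%E.
  rewrite (@ge0_integralD _ _ _ mu _ measurableT (f edge1) (f edge2 \+ f edge3)%E).
  - congr adde; rewrite (@ge0_integralD _ _ _ mu _ measurableT (f edge2) (f edge3)).
    + by [].
    + by move=> t _; exact: rad0.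
    + exact: mrad.
    + by move=> t _; exact: rad0.
    + exact: mrad.
  - by move=> t _; exact: rad0.
  - exact: mrad.
  - by move=> t _; rewrite adde_ge0 ?rad0.
  - by apply: emeasurable_funD; exact: mrad.
apply: eq_integral => t _; rewrite /f.
move: (radial_ge0 edge1 t) (radial_ge0 edge2 t) (radial_ge0 edge3 t).
move: (radial edge1 t) (radial edge2 t) (radial edge3 t) => r1 r2 r3 h1 h2 h3.
by rewrite -addeA ge0_muleDr ?adde_ge0// ge0_muleDr.
Qed.

(** The indicator of [A] is the test function carried through the joint law, the covariogram and the
    sectors. *)
Lemma distance_law (d : measure_display) (Omega : measurableType d)
    (P : probability Omega R) (X Y : {RV P >-> (MR * MR)%type}) (A : set MR) :
  uniform_on X T -> uniform_on Y T -> independent_RVs X Y -> measurable A ->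
  P ((fun w => euclidean_dist (X w) (Y w)) @^-1` A) =
  (\int[mu]_t ((\1[0 < t] * t * \1_A t)%:E *
     (4%:E * (radial edge1 t + radial edge2 t + radial edge3 t))))%E.
Proof.
move=> uX uY XY mA.
have msq := measurable_sqrt; have mnrm := measurable_nrm.
have mtri := measurable_tri; have mov := measurable_overlap.
have mT : measurable T by exact: measurable_right_triangle.
have tri0 := tri_ge0; have A0 := area_gt0.
have mchi : measurable_fun setT (\1_A : MR -> R) by exact: measurable_indic.
have chi0 t : 0 <= \1_A t :> R by [].
pose D (z : (MR * MR) * (MR * MR)) : MR := euclidean_dist z.1 z.2.
have mD : measurable_fun setT D by rewrite /D /euclidean_dist; meas.
have mE : measurable (D @^-1` A).
  by rewrite -[X in measurable X]setTI; exact: mD.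
rewrite -[_ @^-1` A]/((fun w => (X w, Y w)) @^-1` (D @^-1` A)).
rewrite (uniform_joint_law _ _ _ _ _ _ _ (area a b) _ uX uY XY mT A0
  lebesgue_measure2_right_triangle mE).
have mS : measurable ((D @^-1` A) `&` (T `*` T)).
  by apply: measurableI => //; exact: measurableX.
transitivity (((area a b)^-1 ^+ 2)%:E * (\int[mu2]_p \int[mu2]_q
    (\1_A (euclidean_dist p q) * (tri p * tri q))%:E))%E.
  congr (_ * _)%E; rewrite -[LHS]mul1e -[X in (_ * (_ \x _) X)%E]setIT.
  rewrite mul1e -integral_indic//.
  etransitivity.
    apply: (fubini_tonelli1 (m1 := mu2) (m2 := mu2)
      (fun z : (MR * MR) * (MR * MR) => (\1_((D @^-1` A) `&` (T `*` T)) z)%:E)).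
      exact/measurable_EFinP/measurable_indic.
    by move=> z; rewrite lee_fin.
  apply: eq_integral => p _; apply: eq_integral => q _; congr EFin.
  rewrite -!indic_right_triangle// !indicE !natr_andb; congr (nat_of_bool _)%:R.
  by rewrite in_setI in_setX.
rewrite integral_triangle_pairs//.
transitivity (((area a b)^-1 ^+ 2)%:E * ((area a b)%:E * \int[mu]_x \int[mu]_y
    (\1_A (nrm (x, y)) * Num.max 0 (overlap (x, y)) ^+ 2)%:E))%E.
  congr (_ * _)%E; rewrite -(fubini_tonelli1 (m1 := mu) (m2 := mu) (fun v : MR * MR =>
    (\1_A (nrm v) * Num.max 0 (overlap v) ^+ 2)%:E)); last 2 first.
  - by meas.
  - by move=> z; rewrite lee_fin mulr_ge0// sqr_ge0.
  rewrite -ge0_integralZl_EFin ?ltW//; last 2 first.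
  - by move=> v _; rewrite lee_fin mulr_ge0// sqr_ge0.
  - by meas.
  by apply: eq_integral => v _; rewrite -EFinM mulrCA.
rewrite integral_sectors// !muleA -!EFinM.
(* This is [a * b / area a b]; with the 2 due to central symmetry it gives the constant 4. *)
rewrite (_ : _ * _ * _ = 2); last first.
  by rewrite /area; field; rewrite !gt_eqF.
have me1 := measurable_edge1; have me2 := measurable_edge2.
have me3 := measurable_edge3.
have e1 := edge1_gt0; have e2 := edge2_gt0; have e3 := edge3_gt0.
have c0 t : 0 <= \1[0 < t] * t * (2 * \1_A t) :> R.
  by have [t0|t0] := ltP 0 t; rewrite ?mul0r// mul1r mulr_ge0 ?mulr_ge0// ltW.
rewrite -ge0_integralZl_EFin//; last 2 first.
- move=> t _; apply: mule_ge0; first by rewrite lee_fin.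
  by apply: adde_ge0; [apply: adde_ge0|]; exact: radial_ge0.
- apply: emeasurable_funM; first by meas.
  by apply: emeasurable_funD; [apply: emeasurable_funD|]; exact: measurable_radial.
apply: eq_integral => t _; rewrite !muleA -!EFinM; congr (_%:E * _)%E; ring.
Qed.

End law.

(** * Elementary integrals *)

Section strip.
Variable R : realType.
Notation mu := (@lebesgue_measure R).
Notation MR := (measurableTypeR R).
Implicit Types d t m y : R.

Definition hypo d y : R := Num.sqrt (d ^+ 2 + y ^+ 2).

(* With y = d * tan u, a primitive of (1 - t / d * cos u) ^ 2. *)
Definition strip_primitive d t y : R :=
  atan (y / d) - 2 * t * y / (d * hypo d y)
  + t ^+ 2 / 2 * (y / (d * hypo d y ^+ 2) + atan (y / d) / d ^+ 2).

Lemma hypo_gt0 d y : 0 < d -> 0 < hypo d y.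
Proof. by move=> d0; rewrite sqrtr_gt0 ltr_pwDl ?sqr_ge0 ?exprn_gt0. Qed.

Lemma sqr_hypo d y : hypo d y ^+ 2 = d ^+ 2 + y ^+ 2.
Proof. by rewrite sqr_sqrtr// addr_ge0 ?sqr_ge0. Qed.


Lemma is_derive_hypoV d y : 0 < d ->
  is_derive y 1 (fun z => (hypo d z)^-1) (- y * (hypo d y)^-1 ^+ 3).
Proof.
move=> d0; have h0 := hypo_gt0 _ y d0.
have s0 : 0 < d ^+ 2 + y ^+ 2 by rewrite ltr_pwDl ?sqr_ge0 ?exprn_gt0.
have ds := is_derive1_sqrt s0.
have dq : is_derive y 1 (fun z : R => d ^+ 2 + z ^+ 2) (2 * y).
  by apply: is_derive_eq; rewrite /GRing.scale/=; ring.
have dh : is_derive y 1 (hypo d) (y / hypo d y).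
  apply: (is_derive_eq (is_derive1_comp (g := fun z : R => d ^+ 2 + z ^+ 2) ds dq)).
  by rewrite -/(hypo d y); field; rewrite gt_eqF.
apply: (is_derive_eq (is_deriveV _ dh)); first by rewrite gt_eqF.
by rewrite /GRing.scale/=; field; rewrite gt_eqF.
Qed.

Lemma is_derive_atan_div d y : 0 < d ->
  is_derive y 1 (fun z => atan (z / d)) (d * (hypo d y)^-1 ^+ 2).
Proof.
move=> d0; have dq : is_derive y 1 (fun z : R => z / d) d^-1.
  by apply: is_derive_eq; rewrite /GRing.scale/=; ring.
apply: (is_derive_eq
  (is_derive1_comp (g := fun z : R => z / d) (is_derive1_atan (y / d)) dq)).
rewrite exprVn sqr_hypo; field.
by rewrite !gt_eqF// ltr_pwDl ?sqr_ge0 ?exprn_gt0.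
Qed.

Lemma is_derive_strip_primitive d t y : 0 < d ->
  is_derive y 1 (strip_primitive d t)
    (d * ((hypo d y)^-1 ^+ 2 * (1 - t / hypo d y) ^+ 2)).
Proof.
move=> d0; have h0 := hypo_gt0 _ y d0.
pose r (z : R) := (hypo d z)^-1; pose A (z : R) := atan (z / d).
(* A polynomial in [z], [r z] and [A z], whose derivative follows from those of [r] and [A]. *)
have -> : strip_primitive d t = fun z => A z - 2 * t / d * (z * r z) +
    t ^+ 2 / 2 * (d^-1 * (z * r z ^+ 2) + d^-1 ^+ 2 * A z).
  apply/funext => z; rewrite /strip_primitive /r /A; field.
  by rewrite !gt_eqF// hypo_gt0.
have dr : is_derive y 1 r (- y * r y ^+ 3) by exact: is_derive_hypoV.
have dA : is_derive y 1 A (d * r y ^+ 2) by exact: is_derive_atan_div.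
(* Eliminating [y ^+ 2] leaves an identity between rational functions of [r y]. *)
have yE : y ^+ 2 = (r y)^-1 ^+ 2 - d ^+ 2 by rewrite /r invrK sqr_hypo addrC addKr.
apply: is_derive_eq.
rewrite /GRing.scale/= -/(r y).
have r0 : r y != 0 by rewrite invr_eq0 gt_eqF.
transitivity (d * r y ^+ 2 - 2 * t / d * (r y - y ^+ 2 * r y ^+ 3) +
    t ^+ 2 / d * (r y ^+ 2 - y ^+ 2 * r y ^+ 4)).
  by field; rewrite gt_eqF.
by rewrite yE; field; rewrite r0 gt_eqF.
Qed.

Definition strip_integrand d t y : R :=
  d * ((hypo d y)^-1 ^+ 2 * Num.max 0 (1 - t / hypo d y) ^+ 2).

Lemma measurable_hypo d : measurable_fun [set: MR] (hypo d).
Proof.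
apply: (measurableT_comp (f := @Num.sqrt R)); last by meas.
by apply: continuous_measurable_fun; exact: sqrt_continuous.
Qed.

Lemma measurable_strip_integrand d t : 0 < d ->
  measurable_fun [set: MR] (strip_integrand d t).
Proof.
move=> d0.
have mh := measurable_hypo d.
have mhV := measurable_funV_gt0 _ _ mh (hypo_gt0 d ^~ d0).
by rewrite /strip_integrand; meas.
Qed.

Lemma strip_integrand_ge0 d t y : 0 < d -> 0 <= strip_integrand d t y.
Proof. by move=> d0; rewrite mulr_ge0 ?(ltW d0)// mulr_ge0// sqr_ge0. Qed.

Lemma strip_primitive0 d t : strip_primitive d t 0 = 0.
Proof.
by rewrite /strip_primitive !(mul0r, mulr0) atan0 mul0r subr0 addr0 mulr0 addr0.
Qed.

(** The integrand vanishes inside the circle of radius [t]. On the line at distance [d], this circle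
    leaves the segment from the foot to abscissa [m] untouched (up to tangency), cuts it, or
    contains it. *)
Definition strip d t m : R :=
  if t <= d then strip_primitive d t m
  else if t < hypo d m
  then strip_primitive d t m - strip_primitive d t (Num.sqrt (t ^+ 2 - d ^+ 2))
  else 0.

Lemma integral_strip_smooth d t u v : 0 < d -> u <= v ->
  (\int[mu]_(y in `[u, v])
     (d * ((hypo d y)^-1 ^+ 2 * (1 - t / hypo d y) ^+ 2))%:E =
   (strip_primitive d t v - strip_primitive d t u)%:E)%E.
Proof.
move=> d0 uv; apply: integral_itv_is_derive; [exact: uv|move=> y|].
  exact: is_derive_strip_primitive.
have cV : continuous (fun y => (hypo d y)^-1).
  move=> y; apply: differentiable_continuous; apply/derivable1_diffP.
  by have [] := is_derive_hypoV d y d0.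
move=> y; apply: cvgM; first exact: cvg_cst.
apply: cvgM; first by apply: cvgM; exact: cV.
have c1 : (1 - t / hypo d z) @[z --> y] --> 1 - t / hypo d y.
  apply: cvgB; first exact: cvg_cst.
  by apply: cvgM; [exact: cvg_cst|exact: cV].
by apply: cvgM.
Qed.

Lemma integral_strip d t m : 0 < d -> 0 <= t -> 0 <= m ->
  (\int[mu]_y (\1[0 < y] * \1[y < m] * strip_integrand d t y)%:E =
   (strip d t m)%:E)%E.
Proof.
move=> d0 t0 m0.
have mS := measurable_strip_integrand d t d0.
have hypo_le u v : 0 <= u -> u <= v -> hypo d u <= hypo d v.
  move=> u0 uv; rewrite ler_sqrt ?addr_ge0 ?sqr_ge0// lerD2l.
  by rewrite ler_sqr ?nnegrE// (le_trans u0).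
transitivity (\int[mu]_(y in `[0%R, m]) (strip_integrand d t y)%:E)%E.
  rewrite integral_itv_bndoo; last first.
    by apply/measurable_EFinP; exact: measurable_funS mS.
  rewrite [RHS]integral_mkcond; apply: eq_integral => y _.
  rewrite patchE mem_setE in_itv/= natr_andb.
  by case: (_ && _); rewrite ?mul1r ?mul0r.
have pos u : hypo d u <= t -> strip_integrand d t u = 0.
  move=> ut; rewrite /strip_integrand (max_idPl _) ?expr0n ?mulr0//.
  by rewrite subr_le0 ler_pdivlMr ?mul1r// hypo_gt0.
have neg u : t <= hypo d u -> strip_integrand d t u =
   d * ((hypo d u)^-1 ^+ 2 * (1 - t / hypo d u) ^+ 2).
  move=> ut; rewrite /strip_integrand (max_idPr _)//.
  by rewrite subr_ge0 ler_pdivrMr ?mul1r// hypo_gt0.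
rewrite /strip; have [td|dt] := leP t d.
  rewrite -[strip_primitive d t m]subr0 -[X in _ - X](strip_primitive0 d t).
  rewrite -(integral_strip_smooth d t 0 m)//; apply: eq_integral => y _.
  rewrite neg// (le_trans td)// -[leLHS](gtr0_norm d0) -sqrtr_sqr.
  by rewrite ler_sqrt ?addr_ge0 ?sqr_ge0// lerDl sqr_ge0.
have td0 : 0 <= t ^+ 2 - d ^+ 2 by rewrite subr_ge0 ler_sqr ?nnegrE ?(ltW d0) ?(ltW dt).
(* The abscissa where the circle of radius [t] meets the line; the integrand vanishes between 0 and
   [y0]. *)
set y0 := Num.sqrt (t ^+ 2 - d ^+ 2).
have y00 : 0 <= y0 by exact: sqrtr_ge0.
have hy0 : hypo d y0 = t.
  by rewrite /hypo sqr_sqrtr// addrC subrK sqrtr_sqr ger0_norm.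
have [tm|mt] := ltP t (hypo d m); last first.
  apply: integral0_eq => y /=; rewrite in_itv/= => /andP[y1 y2].
  by rewrite pos// (le_trans _ mt)// hypo_le.
have y0m : y0 <= m.
  rewrite -ler_sqr ?nnegrE// sqr_sqrtr// lerBlDl -sqr_hypo ler_sqr ?nnegrE ?(ltW tm)//.
  by rewrite ltW// hypo_gt0.
rewrite -integral_strip_smooth// [LHS]integral_mkcond [RHS]integral_mkcond.
apply: eq_integral => y _; rewrite !patchE !mem_setE !in_itv/=.
have [ym|my] := leP y m; last by rewrite !andbF.
rewrite !andbT; have [y0y|yy0] := leP y0 y.
  by rewrite (le_trans y00 y0y) neg// -hy0 hypo_le.
by case: ifP => // y1; rewrite pos// -hy0 hypo_le// ltW.
Qed.

End strip.

(** * Arctangents as arcsines, and the regimes of a strip *)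

Section arcs.
Variable R : realType.
Implicit Types d t m y x : R.


(** Reads the sign of an arcsine or arctangent off its sine: on [[- pi / 2, 0]] the sine is
    nonpositive. *)
Lemma sin_gt0_pihalf (u : R) : - (pi / 2) <= u -> 0 < sin u -> 0 < u.
Proof.
move=> ugt su; rewrite ltNge; apply/negP => u0.
have : 0 <= sin (- u).
  by apply: sin_ge0_pi; have := pi_gt0 R; move=> p0; apply/andP; split; lra.
by rewrite sinN; lra.
Qed.

Lemma atan_cot (u : R) : 0 < u -> u <= pi / 2 -> atan (cos u / sin u) = pi / 2 - u.
Proof.
move=> u0 u1; rewrite -[RHS]tanK; last first.
  by rewrite in_itv/=; have := pi_gt0 R; move=> *; apply/andP; split; lra.
congr atan; rewrite /tan sinB cosB sin_pihalf cos_pihalf.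
by rewrite !mul0r !mul1r subr0 add0r.
Qed.

Lemma sin_atanE x : sin (atan x) = x * cos (atan x).
Proof.
have c0 : cos (atan x) != 0.
  by apply/lt0r_neq0/cos_gt0_pihalf; rewrite atan_gtNpi2 atan_ltpi2.
by rewrite -{2}[x]atanK /tan divfK.
Qed.

Lemma cos_atan_gt0 x : 0 < cos (atan x).
Proof. by apply/cos_gt0_pihalf; rewrite atan_gtNpi2 atan_ltpi2. Qed.

Lemma atan_gt0 x : 0 < x -> 0 < atan x.
Proof.
move=> x0; apply: sin_gt0_pihalf; first exact/ltW/atan_gtNpi2.
by rewrite sin_atanE mulr_gt0// cos_atan_gt0.
Qed.

Lemma atanV x : 0 < x -> atan x^-1 = pi / 2 - atan x.
Proof.
move=> x0; rewrite -atan_cot ?atan_gt0//; last exact/ltW/atan_ltpi2.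
congr atan; rewrite sin_atanE; field.
by rewrite (gt_eqF x0) (gt_eqF (cos_atan_gt0 _)).
Qed.

(** The argument on the left is the cotangent of [asin (d / t)]. This converts the arctangents of
    the primitives into the arcsines of [L1] and [L2]. *)
Lemma atan_asin d t : 0 < d -> d <= t ->
  atan (Num.sqrt (t ^+ 2 - d ^+ 2) / d) = pi / 2 - asin (d / t).
Proof.
move=> d0 dt; have t0 : 0 < t by exact: lt_le_trans dt.
have dt0 : 0 < d / t by rewrite divr_gt0.
have dt1 : d / t <= 1 by rewrite ler_pdivrMr ?mul1r.
have dtB : -1 <= d / t <= 1 by rewrite dt1 andbT; lra.
have sdt : sin (asin (d / t)) = d / t by rewrite asinK// in_itv.
rewrite -atan_cot.
- congr atan; rewrite cos_asin// sdt.
  have -> : 1 - (d / t) ^+ 2 = (t ^+ 2 - d ^+ 2) / t ^+ 2.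
    by field; rewrite gt_eqF.
  have td0 : 0 <= t ^+ 2 - d ^+ 2 by rewrite subr_ge0 ler_sqr ?nnegrE ?(ltW d0) ?(ltW t0).
  rewrite sqrtrM// sqrtrV ?sqr_ge0// sqrtr_sqr gtr0_norm//; field.
  by rewrite !gt_eqF.
- by apply: sin_gt0_pihalf; rewrite ?sdt// asin_geNpi2.
- exact: asin_lepi2.
Qed.

(** The value of [strip_primitive] at the abscissa where the circle of radius [t] meets the line. *)
Definition strip_cut d t : R :=
  (pi / 2 - asin (d / t)) * (1 + t ^+ 2 / (2 * d ^+ 2))
  - 3 * Num.sqrt (t ^+ 2 - d ^+ 2) / (2 * d).

Lemma strip_primitive_cut d t : 0 < d -> d <= t ->
  strip_primitive R d t (Num.sqrt (t ^+ 2 - d ^+ 2)) = strip_cut d t.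
Proof.
move=> d0 dt; have t0 : 0 < t by exact: lt_le_trans dt.
have td0 : 0 <= t ^+ 2 - d ^+ 2 by rewrite subr_ge0 ler_sqr ?nnegrE ?(ltW d0) ?(ltW t0).
have h : hypo R d (Num.sqrt (t ^+ 2 - d ^+ 2)) = t.
  by rewrite /hypo sqr_sqrtr// addrC subrK sqrtr_sqr gtr0_norm.
rewrite /strip_primitive h atan_asin// /strip_cut; field.
by rewrite !gt_eqF.
Qed.

Lemma strip_low d t m : t <= d -> strip R d t m = strip_primitive R d t m.
Proof. by rewrite /strip => ->. Qed.

(** Both end values of [t] are covered: at [t = d] the cut is the primitive at 0, which vanishes,
    and at [t = hypo R d m] it is the primitive at [m]. *)
Lemma strip_mid d t m : 0 < d -> 0 <= m -> d <= t -> t <= hypo R d m ->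
  strip R d t m = strip_primitive R d t m - strip_cut d t.
Proof.
move=> d0 m0 dt tm; rewrite -strip_primitive_cut// /strip.
have [td|_] := leP t d.
  rewrite (_ : t = d) ?subrr ?sqrtr0 ?strip_primitive0 ?subr0//.
  by apply/eqP; rewrite eq_le td.
have [//|mt] := ltP t (hypo R d m).
have -> : t = hypo R d m by apply/eqP; rewrite eq_le tm.
have -> : hypo R d m ^+ 2 - d ^+ 2 = m ^+ 2 by rewrite sqr_hypo; ring.
by rewrite sqrtr_sqr ger0_norm// subrr.
Qed.

Lemma strip_high d t m : 0 < d -> 0 < m -> hypo R d m <= t -> strip R d t m = 0.
Proof.
move=> d0 m0 mt; rewrite /strip ltNge mt/=.
(* Strict because [0 < m]; this excludes the first branch of [strip]. *)
have dm : d < hypo R d m.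
  rewrite -[ltLHS](gtr0_norm d0) -sqrtr_sqr ltr_sqrt; first by rewrite ltrDl exprn_gt0.
  by rewrite ltr_pwDl ?sqr_ge0 ?exprn_gt0.
by rewrite leNgt (lt_le_trans dm mt).
Qed.

End arcs.

(** * The closed form *)

Section identity.
Variables (R : realType) (a b : R).
Hypotheses (a_gt0 : 0 < a) (b_gt0 : 0 < b).
Notation c := (hyp a b).
Notation h := (height a b).
Notation al := (alpha a b).

Let a_neq0 : a != 0. Proof. by rewrite gt_eqF. Qed.
Let b_neq0 : b != 0. Proof. by rewrite gt_eqF. Qed.

Let sqD_gt0 : 0 < a ^+ 2 + b ^+ 2.
Proof. by rewrite addr_gt0 ?exprn_gt0. Qed.

Let sqD_neq0 : a ^+ 2 + b ^+ 2 != 0.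
Proof. by rewrite gt_eqF. Qed.

Lemma hyp_gt0 : 0 < c.
Proof. by rewrite sqrtr_gt0. Qed.

Let c_neq0 : c != 0. Proof. by rewrite gt_eqF ?hyp_gt0. Qed.

Lemma sqr_hyp : c ^+ 2 = a ^+ 2 + b ^+ 2.
Proof. by rewrite sqr_sqrtr// ltW. Qed.

Lemma heightE : h = a * b / c.
Proof.
rewrite /height /alpha cos_atan.
have -> : 1 + (a / b) ^+ 2 = (a ^+ 2 + b ^+ 2) / b ^+ 2.
  by field; rewrite b_neq0.
rewrite sqrtrM ?(ltW sqD_gt0)// sqrtrV ?sqr_ge0// sqrtr_sqr gtr0_norm//.
by rewrite -/c; field; rewrite b_neq0 c_neq0.
Qed.

Lemma height_gt0 : 0 < h.
Proof. by rewrite heightE divr_gt0 ?mulr_gt0 ?hyp_gt0. Qed.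

Let h_neq0 : h != 0. Proof. by rewrite gt_eqF ?height_gt0. Qed.

Lemma sqr_height : h ^+ 2 = a ^+ 2 * b ^+ 2 / (a ^+ 2 + b ^+ 2).
Proof. by rewrite heightE -sqr_hyp; field; rewrite c_neq0. Qed.

Lemma legs_lt_hyp : a < c /\ b < c.
Proof.
by split; rewrite -ltr_sqr ?nnegrE ?(ltW hyp_gt0) ?(ltW a_gt0) ?(ltW b_gt0)//
  sqr_hyp ?ltrDl ?ltrDr exprn_gt0.
Qed.

Lemma height_lt_legs : h < a /\ h < b.
Proof.
have [ac bc] := legs_lt_hyp; rewrite heightE.
by split; rewrite ltr_pdivrMr ?hyp_gt0// ?ltr_pM2l// mulrC ltr_pM2l.
Qed.

(** The altitude cuts the hypotenuse into segments of lengths [b ^+ 2 / c] and [a ^+ 2 / c]; this is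
    Pythagoras in the part next to the vertex [(0, b)]. *)
Lemma hypo_foot_b : hypo R h (b ^+ 2 / c) = b.
Proof.
rewrite -[RHS](gtr0_norm b_gt0) -sqrtr_sqr; congr Num.sqrt.
have -> : (b ^+ 2 / c) ^+ 2 = b ^+ 4 / (a ^+ 2 + b ^+ 2).
  by rewrite -sqr_hyp; field; rewrite c_neq0.
by rewrite sqr_height; field; rewrite sqD_neq0.
Qed.

Lemma hypo_foot_a : hypo R h (a ^+ 2 / c) = a.
Proof.
rewrite -[RHS](gtr0_norm a_gt0) -sqrtr_sqr; congr Num.sqrt.
have -> : (a ^+ 2 / c) ^+ 2 = a ^+ 4 / (a ^+ 2 + b ^+ 2).
  by rewrite -sqr_hyp; field; rewrite c_neq0.
by rewrite sqr_height; field; rewrite sqD_neq0.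
Qed.

Lemma hypo_legs : hypo R a b = c /\ hypo R b a = c.
Proof. by split=> //; rewrite /hypo addrC. Qed.

Let atan_ba : atan (b / a) = pi / 2 - al.
Proof. by rewrite -[b / a]invf_div atanV// divr_gt0. Qed.

(** Seen from the right angle, this segment subtends the angle [pi / 2 - al]; moreover
    [1 / h ^+ 2 = 1 / a ^+ 2 + 1 / b ^+ 2]. *)
Lemma strip_primitive_foot_b t : strip_primitive R h t (b ^+ 2 / c) =
  (pi / 2 - al) - 2 * t / a
  + t ^+ 2 / 2 * (1 / (a * b) + (pi / 2 - al) * (1 / a ^+ 2 + 1 / b ^+ 2)).
Proof.
rewrite /strip_primitive hypo_foot_b sqr_height.
have -> : b ^+ 2 / c / h = b / a.
  by rewrite heightE; field; rewrite a_neq0 b_neq0 c_neq0.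
rewrite atan_ba heightE; field.
by rewrite sqD_neq0 a_neq0 b_neq0 c_neq0.
Qed.

Lemma strip_primitive_foot_a t : strip_primitive R h t (a ^+ 2 / c) =
  al - 2 * t / b
  + t ^+ 2 / 2 * (1 / (a * b) + al * (1 / a ^+ 2 + 1 / b ^+ 2)).
Proof.
rewrite /strip_primitive hypo_foot_a sqr_height.
have -> : a ^+ 2 / c / h = a / b.
  by rewrite heightE; field; rewrite a_neq0 b_neq0 c_neq0.
rewrite -/al heightE; field.
by rewrite sqD_neq0 a_neq0 b_neq0 c_neq0.
Qed.

(** Taken together, the angles add up to [pi / 2], and the terms linear in [t] combine through
    [c ^+ 2 = a ^+ 2 + b ^+ 2]. *)
Lemma strip_primitive_legs t :
  strip_primitive R a t b + strip_primitive R b t a =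
  pi / 2 - 2 * t * c / (a * b)
  + t ^+ 2 / 2 * (1 / (a * b) + (pi / 2 - al) / a ^+ 2 + al / b ^+ 2).
Proof.
have [ab ba] := hypo_legs.
rewrite /strip_primitive ab ba sqr_hyp atan_ba -/al.
have -> : 2 * t * c / (a * b) = 2 * t * (a ^+ 2 + b ^+ 2) / (a * b * c).
  by rewrite -sqr_hyp; field; rewrite a_neq0 b_neq0 c_neq0.
field.
by rewrite sqD_neq0 a_neq0 b_neq0 c_neq0.
Qed.

Lemma strip_cut_height t : strip_cut R h t =
  (pi / 2 - asin (h / t)) * (1 + t ^+ 2 / 2 * (1 / a ^+ 2 + 1 / b ^+ 2))
  - 3 * Num.sqrt (t ^+ 2 - h ^+ 2) * c / (2 * (a * b)).
Proof.
rewrite /strip_cut; set S := Num.sqrt _; set A := asin _.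
rewrite sqr_height heightE; field.
by rewrite sqD_neq0 a_neq0 b_neq0 c_neq0.
Qed.

(* The part of H2 and H3 coming from the side at distance h; since c ^ 2 has been
   eliminated, c only occurs linearly. *)
Definition height_arc t : R :=
  3 / 2 * (c * Num.sqrt (t ^+ 2 - h ^+ 2))
  + (Theta3 a b * t ^+ 2 / 2 + a * b) * asin (h / t).

Lemma height_arcE t :
  Theta3 a b * L1 t h + c * L2 t h = height_arc t.
Proof.
rewrite /height_arc /L1 /L2; set S := Num.sqrt _; set A := asin _.
(* Twice the area, computed in two ways; with the next relation it eliminates [h] outside the root
   and the arcsine. *)
have ch : c * h = a * b by rewrite heightE mulrC divfK.
have th : Theta3 a b * h = c.
  apply: (mulfI c_neq0); rewrite mulrCA ch -expr2 sqr_hyp /Theta3; field.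
  by rewrite a_neq0 b_neq0.
transitivity ((Theta3 a b * h) * S / 2 + Theta3 a b * t ^+ 2 * A / 2
  + c * S + (c * h) * A); first by field.
by rewrite th ch; field.
Qed.

Lemma asin1 : asin 1 = pi / 2 :> R.
Proof.
rewrite -[X in asin X]sin_pihalf sinK// in_itv/= lexx andbT.
by have := pi_gt0 R; lra.
Qed.

Let al_gt0 : 0 < al. Proof. by rewrite atan_gt0// divr_gt0. Qed.
Let al_lt : al < pi / 2. Proof. exact: atan_ltpi2. Qed.

(** By definition [h = a * cos al], and the cosine is the sine of the complement. *)
Lemma asin_height_a : asin (h / a) = pi / 2 - al.
Proof.
have -> : h / a = sin (pi / 2 - al).
  rewrite sinB sin_pihalf cos_pihalf mul0r subr0 mul1r /height.
  by rewrite mulrC mulKf.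
rewrite sinK// in_itv/=.
by move: al_gt0 al_lt; have := pi_gt0 R; move=> *; apply/andP; split; lra.
Qed.

Lemma asin_height_b : asin (h / b) = al.
Proof.
have -> : h / b = sin al.
  by rewrite sin_atanE /height -/al; field.
rewrite sinK// in_itv/=.
by move: al_gt0 al_lt; have := pi_gt0 R; move=> *; apply/andP; split; lra.
Qed.

Lemma height_arc_h : height_arc h = (Theta3 a b * h ^+ 2 / 2 + a * b) * (pi / 2).
Proof. by rewrite /height_arc subrr sqrtr0 !mulr0 add0r divff// asin1. Qed.

Lemma height_arc_a : height_arc a =
  3 / 2 * a ^+ 2 + (Theta3 a b * a ^+ 2 / 2 + a * b) * (pi / 2 - al).
Proof.
rewrite /height_arc asin_height_a.
(* The leg [a] projects onto the hypotenuse with length [a ^+ 2 / c]. *)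
have -> : a ^+ 2 - h ^+ 2 = (a ^+ 2 / c) ^+ 2.
  by rewrite -{1}hypo_foot_a sqr_hypo addrC addKr.
by rewrite sqrtr_sqr ger0_norm ?divr_ge0 ?sqr_ge0 ?(ltW hyp_gt0)// [c * _]mulrC divfK.
Qed.

Lemma height_arc_b : height_arc b =
  3 / 2 * b ^+ 2 + (Theta3 a b * b ^+ 2 / 2 + a * b) * al.
Proof.
rewrite /height_arc asin_height_b.
have -> : b ^+ 2 - h ^+ 2 = (b ^+ 2 / c) ^+ 2.
  by rewrite -{1}hypo_foot_b sqr_hypo addrC addKr.
by rewrite sqrtr_sqr ger0_norm ?divr_ge0 ?sqr_ge0 ?(ltW hyp_gt0)// [c * _]mulrC divfK.
Qed.

Lemma L1_diag x : x != 0 -> L1 x x = x ^+ 2 * pi / 4 :> R.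
Proof. by move=> x0; rewrite /L1 subrr sqrtr0 mulr0 add0r divff// asin1; field. Qed.

Lemma L2_diag x : x != 0 -> L2 x x = x * pi / 2 :> R.
Proof. by move=> x0; rewrite /L2 subrr sqrtr0 add0r divff// asin1 mulrA. Qed.

Lemma H2E t : H2 a b t = Theta2 a b * t ^+ 2 / 8 + height_arc t.
Proof. by rewrite /H2 -addrA height_arcE. Qed.

Lemma H3E t : H3 a b t = a * t + Theta4 a b * t ^+ 2 / 2 + height_arc t / 2
  + b / (2 * a) * L1 t a + b / 2 * L2 t a.
Proof. by rewrite /H3 -height_arcE; field; rewrite a_neq0. Qed.

(** The side at distance [h] gives two strips, one on each side of the foot of the altitude; the
    sides at distances [a] and [b] start at their feet and give one each. *)
Definition strips t : R :=
  strip R h t (b ^+ 2 / c) + strip R h t (a ^+ 2 / c) + strip R a t b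
  + strip R b t a.

Lemma strips_gt_hyp t : c <= t -> strips t = 0.
Proof.
move=> ct; have [ac bc] := legs_lt_hyp; have [ab ba] := hypo_legs.
have h0 := height_gt0; have c0 := hyp_gt0.
have fa0 : 0 < a ^+ 2 / c by rewrite divr_gt0 ?exprn_gt0.
have fb0 : 0 < b ^+ 2 / c by rewrite divr_gt0 ?exprn_gt0.
have at_ := le_trans (ltW ac) ct; have bt := le_trans (ltW bc) ct.
by rewrite /strips !strip_high ?addr0 ?ab ?ba ?hypo_foot_a ?hypo_foot_b.
Qed.

(** Each regime of [Jstar] decides which strips are whole, cut or empty. The roots and arcsines are
    then indeterminates for [field]. *)
Lemma stripsE t : a <= b -> 0 < t -> t <= c ->
  strips t = pi + (Jstar a b t - perimeter a b * t) / area a b.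
Proof.
move=> le_ab t0 tc.
have [ac bc] := legs_lt_hyp; have [ha hb] := height_lt_legs.
have [ab ba] := hypo_legs; have h0 := height_gt0; have c0 := hyp_gt0.
have fa0 : 0 < a ^+ 2 / c by rewrite divr_gt0 ?exprn_gt0.
have fb0 : 0 < b ^+ 2 / c by rewrite divr_gt0 ?exprn_gt0.
have legs := strip_primitive_legs t.
(* Solved for one primitive, because a cut separates the two in the sum; the other one then
   cancels. *)
have legs' : strip_primitive R a t b = pi / 2 - 2 * t * c / (a * b)
  + t ^+ 2 / 2 * (1 / (a * b) + (pi / 2 - al) / a ^+ 2 + al / b ^+ 2)
  - strip_primitive R b t a by rewrite -legs addrK.
rewrite /strips /Jstar -/h; have [th|ht] := ltP t h.
  have ta : t <= a by rewrite ltW// (lt_trans th).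
  have tb : t <= b by rewrite (le_trans ta).
  rewrite (strip_low _ h _ _ (ltW th)) (strip_low _ h _ _ (ltW th)).
  rewrite (strip_low _ a)// (strip_low _ b)// -addrA legs.
  rewrite strip_primitive_foot_a strip_primitive_foot_b.
  rewrite /J1 /H1 /Theta1 /perimeter /area; field.
  by rewrite a_neq0 b_neq0.
(* For [h <= t < a], both strips at distance [h] are cut. *)
have [ta|at_] := ltP t a.
  have tb : t < b by rewrite (lt_le_trans ta).
  rewrite (strip_mid _ h) ?hypo_foot_b ?(ltW fb0) ?(ltW tb)//.
  rewrite (strip_mid _ h) ?hypo_foot_a ?(ltW fa0) ?(ltW ta)//.
  rewrite (strip_low _ a) ?(ltW ta)// (strip_low _ b) ?(ltW tb)// -addrA legs.
  rewrite strip_primitive_foot_a strip_primitive_foot_b strip_cut_height.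
  (* The terms in [h ^+ 2] cancel since [Theta1 - Theta2 = 2 * pi * Theta3]. *)
  rewrite /J1 /J2 /H1 !H2E height_arc_h /height_arc.
  rewrite /Theta1 /Theta2 /Theta3 /perimeter /area; field.
  by rewrite a_neq0 b_neq0.
(* For [a <= t < b], of the strips at distance [h] the one of length [a ^+ 2 / c] is empty and the
   other is cut, as is the strip at distance [a]. *)
have [tb|bt] := ltP t b.
  rewrite (strip_mid _ h) ?hypo_foot_b ?(ltW fb0) ?(ltW tb)//.
  rewrite (strip_high _ h) ?hypo_foot_a// addr0.
  rewrite (strip_mid _ a) ?ab ?(ltW b_gt0)//.
  rewrite (strip_low _ b) ?(ltW tb)//.
  rewrite legs' strip_primitive_foot_b strip_cut_height.
  rewrite /J1 /J2 /J3 /H1 !H2E !H3E height_arc_h height_arc_a.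
  rewrite (L1_diag a)// (L2_diag a)// /strip_cut /height_arc /L1 /L2.
  rewrite /Theta1 /Theta2 /Theta3 /Theta4 /perimeter /area; field.
  by rewrite a_neq0 b_neq0.
(* For [b <= t <= c], the strips at distance [h] are empty and those at distances [a] and [b] are
   cut. *)
rewrite (strip_high _ h) ?hypo_foot_b// (strip_high _ h) ?hypo_foot_a//.
rewrite (strip_mid _ a) ?ab ?(ltW b_gt0)// (strip_mid _ b) ?ba ?(ltW a_gt0)//.
rewrite legs' /J1 /J2 /J3 /J4 /H1 !H2E !H3E /H4.
rewrite height_arc_h height_arc_a height_arc_b.
rewrite (L1_diag a)// (L2_diag a)// (L1_diag b)// (L2_diag b)//.
rewrite /strip_cut /L1 /L2.
rewrite /Theta1 /Theta2 /Theta3 /Theta4 /Theta5 /Theta6 /perimeter /area; field.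
by rewrite a_neq0 b_neq0.
Qed.

End identity.

(** * From strips to the density of the distance *)

Section density.
Variables (R : realType) (a b : R).
Hypotheses (a_gt0 : 0 < a) (b_gt0 : 0 < b).
Notation mu := (@lebesgue_measure R).
Notation MR := (measurableTypeR R).
Notation c := (hyp a b).
Notation h := (height a b).

(** The substitution [y = m * w]; the factor [d] of [k] is the one built into [strip_integrand]. *)
Lemma integral_dilated_strip (d m t : R) (rho : MR -> R) (k : R) : 0 < d -> 0 < m ->
  0 <= t -> k = d * m -> (forall w, rho w = hypo R d (m * w)) ->
  (k%:E * radial R rho t = (strip R d t m)%:E)%E.
Proof.
move=> d0 m0 t0 -> rhoE.
have mS := measurable_strip_integrand R d t d0.
have S0 := strip_integrand_ge0 R d t ^~ d0.
rewrite -integral_strip// ?(ltW m0)//.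
rewrite (ge0_integral_affine _ m 0) ?gt_eqF//; last 2 first.
- by meas.
- by move=> y; rewrite lee_fin mulr_ge0.
rewrite gtr0_norm// EFinM -muleA muleCA; congr (_ * _)%E.
rewrite /radial -ge0_integralZl_EFin ?(ltW d0)//; last 2 first.
- by move=> w _; rewrite lee_fin mulr_ge0// mulr_ge0// sqr_ge0.
- apply: measurable_radial_integrand => [|w]; last by rewrite rhoE hypo_gt0.
  rewrite (_ : rho = hypo R d \o ( *%R m)); last by apply/funext => w; rewrite rhoE.
  by apply: measurableT_comp => //; exact: measurable_hypo.
apply: eq_integral => w _; rewrite addr0 -EFinM; congr EFin.
have -> : (m * w < m) = (w < 1) by rewrite -[X in _ < X]mulr1 ltr_pM2l.
by rewrite /strip_integrand -rhoE pmulr_rgt0//; ring.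
Qed.

Lemma radial_edge2 t : 0 <= t ->
  ((a * b)%:E * radial R (edge2 R a b) t = (strip R a t b)%:E)%E.
Proof. by move=> t0; apply: integral_dilated_strip. Qed.

Lemma radial_edge3 t : 0 <= t ->
  ((a * b)%:E * radial R (edge3 R a b) t = (strip R b t a)%:E)%E.
Proof.
move=> t0; apply: integral_dilated_strip => //; first by rewrite mulrC.
by move=> w; rewrite /edge3 /hypo addrC.
Qed.

(* The altitude onto the hypotenuse splits the corresponding sector in two. *)
Lemma radial_edge1 t : 0 <= t ->
  ((a * b)%:E * radial R (edge1 R a b) t =
   (strip R h t (b ^+ 2 / c) + strip R h t (a ^+ 2 / c))%:E)%E.
Proof.
move=> t0.
have c0 := hyp_gt0 R a b a_gt0 b_gt0; have h0 := height_gt0 R a b a_gt0 b_gt0.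
have cc := sqr_hyp R a b a_gt0 b_gt0.
have hE := heightE R a b a_gt0 b_gt0.
have fa0 : 0 <= a ^+ 2 / c by rewrite divr_ge0 ?sqr_ge0 ?(ltW c0).
have fb0 : 0 <= b ^+ 2 / c by rewrite divr_ge0 ?sqr_ge0 ?(ltW c0).
have mS := measurable_strip_integrand R h t h0.
have S0 := strip_integrand_ge0 R h t ^~ h0.
(* Here [y = c * w - b ^+ 2 / c] is the abscissa along the hypotenuse from the foot of the altitude;
   [w = 0] is the vertex [(0, b)]. *)
pose f y : R := \1[- (b ^+ 2 / c) < y] * \1[y < a ^+ 2 / c] * strip_integrand R h t y.
have mf : measurable_fun [set: MR] f by rewrite /f; meas.
have f0 y : 0 <= f y by rewrite /f mulr_ge0.
transitivity (\int[mu]_y (f y)%:E)%E.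
  rewrite (ge0_integral_affine _ c (- (b ^+ 2 / c))) ?gt_eqF//; last by meas.
  rewrite gtr0_norm// (_ : a * b = c * h); last first.
    by rewrite hE [RHS]mulrC divfK// gt_eqF.
  rewrite EFinM -muleA; congr (_ * _)%E.
  rewrite /radial -ge0_integralZl_EFin ?(ltW h0)//; last 2 first.
  - by move=> w _; rewrite lee_fin mulr_ge0// mulr_ge0// sqr_ge0.
  - apply: measurable_radial_integrand; first exact: measurable_edge1.
    exact: edge1_gt0.
  apply: eq_integral => w _; rewrite -EFinM; congr EFin; rewrite /f.
  have -> : (- (b ^+ 2 / c) < c * w - b ^+ 2 / c) = (0 < w).
    by rewrite -subr_gt0 opprK subrK pmulr_rgt0.
  have -> : (c * w - b ^+ 2 / c < a ^+ 2 / c) = (w < 1).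
    rewrite ltrBlDr -mulrDl -cc expr2 mulfK ?gt_eqF//.
    by rewrite -[X in _ < X]mulr1 ltr_pM2l.
  rewrite /strip_integrand (_ : hypo R h _ = edge1 R a b w); first by ring.
  congr Num.sqrt; rewrite (sqr_height R a b a_gt0 b_gt0).
  have -> : (c * w - b ^+ 2 / c) ^+ 2 =
      c ^+ 2 * w ^+ 2 - 2 * b ^+ 2 * w + b ^+ 4 / c ^+ 2.
    by field; rewrite gt_eqF.
  rewrite cc; field.
  by rewrite gt_eqF// addr_gt0 ?exprn_gt0.
(* Since [strip_integrand] is even in [y], folding at the foot yields the two strips. *)
rewrite ge0_integral_half//; last by meas.
rewrite EFinD -!integral_strip//.
have mg m : measurable_fun [set: MR] (fun y : MR =>
    (\1[0 < y] * \1[y < m] * strip_integrand R h t y)%:E) by meas.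
rewrite -ge0_integralD//; last 2 first.
- by move=> y _; rewrite lee_fin mulr_ge0.
- by move=> y _; rewrite lee_fin mulr_ge0.
apply: eq_integral => y _; rewrite -!EFinD -EFinM; congr EFin.
have [y0|] := ltP 0 y; last by rewrite !mul0r addr0.
rewrite /f (_ : strip_integrand R h t (- y) = strip_integrand R h t y); last first.
  by rewrite /strip_integrand /hypo sqrrN.
rewrite ltrN2 (_ : (- (b ^+ 2 / c) < y) = true); last by apply/idP; lra.
rewrite (_ : (- y < a ^+ 2 / c) = true); last by apply/idP; lra.
rewrite /= !mulr1n; ring.
Qed.

Lemma radial_strips t : 0 <= t ->
  ((a * b)%:E * (radial R (edge1 R a b) t + radial R (edge2 R a b) t
     + radial R (edge3 R a b) t) = (strips R a b t)%:E)%E.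
Proof.
move=> t0.
move: (radial_edge1 t t0) (radial_edge2 t t0) (radial_edge3 t t0).
move: (radial_ge0 R (edge1 R a b) t) (radial_ge0 R (edge2 R a b) t).
move: (radial_ge0 R (edge3 R a b) t).
move: (radial R (edge1 R a b) t) (radial R (edge2 R a b) t)
  (radial R (edge3 R a b) t) => r1 r2 r3 r30 r10 r20 e1 e2 e3.
by rewrite ge0_muleDr ?adde_ge0// ge0_muleDr// e1 e2 e3.
Qed.

Lemma distance_densityE t : a <= b ->
  ((distance_density a b t)%:E = (\1[0 < t] * t)%:E * (4%:E *
    (radial R (edge1 R a b) t + radial R (edge2 R a b) t + radial R (edge3 R a b) t)))%E.
Proof.
move=> le_ab; rewrite /distance_density.
have [t0|t0] := ltP 0 t; last first.
  (* Only [t = 0] meets the closed range here, and there the factor [t] vanishes. *)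
  rewrite mul0r mul0e; case: ifP => // /andP[t0' _].
  have -> : t = 0 by apply/eqP; rewrite eq_le t0.
  by rewrite mulr0 !mul0r.
rewrite mul1r muleA -EFinM.
(* The factor [a * b] turns the radial functions into [strips]; the rest is [2 * t / area a b]. *)
have -> : t * 4 = 4 * t / (a * b) * (a * b).
  by field; rewrite !gt_eqF.
rewrite EFinM -muleA radial_strips ?(ltW t0)// -EFinM; congr EFin.
rewrite /=; have [tc|tc] := leP t c.
  by rewrite (stripsE R a b a_gt0 b_gt0)// /area; field; rewrite !gt_eqF.
by rewrite (strips_gt_hyp R a b a_gt0 b_gt0) ?mulr0 ?(ltW tc).
Qed.

End density.

Theorem theorem2 (R : realType) (a b : R) (a_gt0 : 0 < a) (le_ab : a <= b)
    (d : measure_display) (Omega : measurableType d)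
    (P : probability Omega R)
    (X Y : {RV P >-> (measurableTypeR R * measurableTypeR R)%type})
    (X_unif : uniform_on X (right_triangle a b))
    (Y_unif : uniform_on Y (right_triangle a b))
    (XY_indep : independent_RVs X Y) :
  has_density P (fun w => euclidean_dist (X w) (Y w)) (distance_density a b).
Proof.
have b_gt0 : 0 < b by exact: lt_le_trans le_ab.
(* Measurability and nonnegativity of the density are read off this integral form rather than the
   closed formula. *)
have gE t := distance_densityE R a b a_gt0 b_gt0 t le_ab.
split.
- have mX : measurable_fun setT X by exact: measurable_funPT.
  have mY : measurable_fun setT Y by exact: measurable_funPT.
  have msqrt : measurable_fun [set: measurableTypeR R] (@Num.sqrt R).
    by apply: continuous_measurable_fun; exact: sqrt_continuous.
  by rewrite /euclidean_dist; meas.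
- apply/measurable_EFinP.
  have -> : EFin \o distance_density a b = fun t : measurableTypeR R =>
      ((\1[0 < t] * t)%:E * (4%:E *
    (radial R (edge1 R a b) t + radial R (edge2 R a b) t + radial R (edge3 R a b) t)))%E.
    by apply/funext => t; rewrite /= gE.
  apply: emeasurable_funM; first by meas.
  apply: emeasurable_funM; first exact: measurable_cst.
  apply: emeasurable_funD; [apply: emeasurable_funD|]; apply: measurable_radial.
  - exact: measurable_edge1.
  - exact: edge1_gt0.
  - exact: measurable_edge2.
  - exact: edge2_gt0.
  - exact: measurable_edge3.
  - exact: edge3_gt0.
- move=> t; rewrite -lee_fin gE mule_ge0//.
    by rewrite lee_fin; have [t0|t0] := ltP 0 t; rewrite ?mul0r// mul1r ltW.
  apply: mule_ge0; first by rewrite lee_fin.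
  by apply: adde_ge0; [apply: adde_ge0|]; exact: radial_ge0.
- move=> A mA; rewrite (distance_law R a b)//.
  rewrite [RHS]integral_mkcond; apply: eq_integral => t _.
  rewrite patchE indicE; case: ifP => _; last by rewrite mulr0 mul0e.
  by rewrite mulr1 gE.
Qed.
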